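(* Let $f$ be a meromorphic function on $\mathbb{C}$, regarded as a holomorphic map $f:\mathbb{C}\to\mathbb{P}_1(\mathbb{C})$, and assume that $f$ is Brody. Let $R$ be a rational function with $R(\infty)\notin\{0,\infty\}$. Then the meromorphic function $g=Rf$ is Brody.
   Context: For a meromorphic function $f$ on $\mathbb{C}$ the spherical derivative is $f^\#(z)=\frac{|f'(z)|}{1+|f(z)|^2}$, extended continuously to the poles of $f$ (equivalently, computed there as $(1/f)^\#$). The function $f$ is called Brody if $f^\#$ is bounded on $\mathbb{C}$. $R(\infty)$ denotes $\lim_{z\to\infty}R(z)\in\mathbb{C}\cup\{\infty\}$. *)

(* Defs.v *)
From HB Require Import structures.
From mathcomp Require Import all_boot all_order all_algebra.
From mathcomp Require Import complex.
From mathcomp Require Import all_classical all_reals all_analysis.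

Set Implicit Arguments.
Unset Strict Implicit.
Unset Printing Implicit Defensive.

Import Order.TTheory GRing.Theory Num.Theory.
Import numFieldNormedType.Exports.

Local Open Scope classical_set_scope.
Local Open Scope ring_scope.

(* R[i] carries no topology by itself; seen as a numClosedFieldType it
   receives the topology of its norm from numFieldNormedType. *)
Definition Cplx (R : realType) : numClosedFieldType := R[i].

(* The Riemann sphere; the point at infinity is None. *)
Definition P1 (R : realType) : ptopologicalType :=
  one_point_compactification (Cplx R).

Section Sphere.
Context {R : realType}.
Local Notation C := (Cplx R).
Local Notation P1 := (P1 R).
Implicit Types (f g : C -> P1) (z : C).

Definition infty : P1 := None.
Definition fin (a : C) : P1 := Some a.

(* The two standard charts w and 1/w of the sphere, each with the junk value 0
   at the point outside its domain: infty for chart0, fin 0 for chart_infty. *)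
Definition chart0 (x : P1) : C := if x is Some a then a else 0.
Definition chart_infty (x : P1) : C := if x is Some a then a^-1 else 0.

(* By continuity of f, the sets where f avoids infty, resp. fin 0, are open, so
   the two derivability clauses say that f is holomorphic there when read in
   the corresponding chart. *)
Definition holomorphic_map f : Prop :=
  [/\ continuous f,
      forall z, f z <> infty -> derivable (chart0 \o f) z 1
    & forall z, f z <> fin 0 -> derivable (chart_infty \o f) z 1].

Definition meromorphic f : Prop :=
  holomorphic_map f /\ exists z, f z <> infty.

Definition spherical_derivative f z : C :=
  let h := (if f z is Some _ then chart0 else chart_infty) \o f in
  `|derive1 h z| / (1 + `|h z| ^+ 2).

Definition brody f : Prop := bounded_fun (spherical_derivative f).

(* p / q in lowest terms, so that the zeros of q are exactly the poles. *)
Definition rational_function f : Prop :=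
  exists p q : {poly C}, [/\ q != 0, coprimep p q &
    forall z, f z = if root q z then infty else fin (p.[z] / q.[z])].

Definition infty_filter : set_system C :=
  [set A | exists M : R, forall z, real_complex R M < `|z| -> A z].

Definition value_at_infty f : P1 := lim (f @ infty_filter).

(* The product of two meromorphic functions is their pointwise product off the
   poles, extended by its limits. The value None at a pole of a factor is
   junk: poles are isolated, and the limit ignores the center. *)
Definition mul_off_poles (x y : P1) : P1 :=
  if (x, y) is (Some a, Some b) then fin (a * b) else infty.

Definition mero_mul f g : C -> P1 :=
  fun z => lim ((fun w => mul_off_poles (f w) (g w)) @ z^').

End Sphere.

(* Main.v *)
From HB Require Import structures.
Require Import Defs.
From mathcomp Require Import all_boot all_order all_algebra.
From mathcomp Require Import complex.
From mathcomp Require Import all_classical all_reals all_analysis.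
From mathcomp Require Import ring lra.

(** The product of [f] with a rational function [r = p / q] can only fail to be
Brody near infinity, where it is controlled by [f], or at the finitely many
zeros and poles of [r], where everything is local. Both regions are handled by
writing meromorphic maps in homogeneous coordinates: near each point [f] is
[A : B] with [A], [B] holomorphic without common zero, and then
[[
  f# = |A' B - A B'| / (|A|^2 + |B|^2),
]]
a formula that treats zeros, poles and ordinary points alike
([spherical_derivative_quo]).

Near infinity, the hypothesis on the value of [r] means that [p] and [q] have
the same degree [n], so [p] and [q] are both comparable to [z^n] and
[p' q - p q'] is [O (z^(2n))]. As [r f] is [pA : qB] and
[[
  (pA)' (qB) - (pA) (qB)' = p q (A' B - A B') + (p' q - p q') A B,
]]
dividing by [|pA|^2 + |qB|^2] gives [(r f)# <= const (f# + 1)]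
([wronskian_quotient_bound]).

Near a finite point [z], the coordinates [p A] and [q B] may vanish together.
Dividing both by the common power of [w - z] yields holomorphic coordinates of
[r f] without common zero, so [r f] is holomorphic and its spherical derivative
is bounded near [z] ([cancel_common_zeros], [quotient_at_locally_bounded]). A
compact disc is covered by finitely many such neighbourhoods.

The division rests on the fact that a holomorphic function either vanishes near
[z] or is [(w - z)^n Q w] with [Q] holomorphic and [Q z] nonzero
([regular_order]). It comes from Cauchy's formula: a holomorphic [F] is locally
a Cauchy transform, the integral over a circle of [psi / (zeta - w)], such
transforms can be divided by [w - a] explicitly by changing [psi] into
[psi / (zeta - a)], and the standard estimate for the [n]-th quotient forces
[F = 0] when all quotients vanish at [a].

Cauchy's formula is proved by contracting the circle to a point and
differentiating under the integral sign ([homotopy_period_int]). This requires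
a bound on [F'] but no continuity, and the bound is exactly what the Brody
hypothesis provides: a bound on [f#] is a bound on the derivative of [f], or of
[1 / f], near each point ([regular_chart0], [regular_chart_infty]).

That [B] vanishes only at isolated points is used to identify the product with
its limit at the poles. If [B] vanished near some point, [f] would be infinite
on a nonempty open set, which is also closed by the dichotomy above, hence
everywhere ([not_locally_infty]). *)

Set Implicit Arguments.
Unset Strict Implicit.
Unset Printing Implicit Defensive.

Import Order.TTheory GRing.Theory Num.Theory.
Import numFieldNormedType.Exports.

Local Open Scope classical_set_scope.
Local Open Scope ring_scope.

(** * Real integrals depending on a parameter *)

Section RealIntegral.
Context {R : realType}.
Implicit Types (h : R -> R).
Local Notation mu := (@lebesgue_measure R).

Lemma continuous_integrable h (a b : R) : continuous h ->
  mu.-integrable `[a, b] (EFin \o h).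
Proof.
move=> ch; apply: continuous_compact_integrable; first exact: segment_compact.
exact: continuous_subspaceT.
Qed.

Lemma derivable_continuous h : (forall t, derivable h t 1) -> continuous h.
Proof. by move=> dh t; apply/differentiable_continuous/derivable1_diffP. Qed.

Lemma continuous_primitive h (c : R) : continuous h ->
  exists P : R -> R, forall x, c < x -> is_derive x 1 P (h x).
Proof.
move=> ch; exists (fun x => \int[mu]_(t in `[c, x]) h t) => x cx.
have [] := @continuous_FTC1_closed R h c x (x + 1) _ _ cx (ch x).
- by rewrite ltrDl.
- exact: continuous_integrable.
by move=> dP <-; rewrite derive1E; exact: derivableP.
Qed.

Lemma Rintegral_continuous_FTC2 h P (a b : R) : a < b -> continuous h ->
  (forall x, a <= x <= b -> is_derive x 1 P (h x)) ->
  \int[mu]_(t in `[a, b]) h t = P b - P a.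
Proof.
move=> ab ch dP; rewrite /Rintegral (@continuous_FTC2 _ h P)//.
- exact: continuous_subspaceT.
- have cP x : a <= x <= b -> {for x, continuous P}.
    move=> /dP dPx; apply/differentiable_continuous/derivable1_diffP.
    exact: ex_derive.
  split.
  + by move=> x /[!in_itv]/= /andP[ax xb];
      apply: (@ex_derive _ _ _ _ _ _ _ (dP x _)); rewrite !ltW.
  + by apply: cvg_at_right_filter; apply: cP; rewrite lexx ltW.
  + by apply: cvg_at_left_filter; apply: cP; rewrite lexx ltW.
- move=> x /[!in_itv]/= /andP[ax xb]; rewrite derive1E.
  by apply: (@derive_val _ _ _ _ _ _ _ (dP x _)); rewrite !ltW.
Qed.

Lemma is_derive_translate h (d c x : R) :
  is_derive (c + x) 1 h d -> is_derive x 1 (fun y => h (c + y)) d.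
Proof.
move=> dh; have -> : (fun y => h (c + y)) = h \o (fun y => c + y) by [].
have := @is_derive1_comp R h (fun y => c + y) x d 1 dh.
rewrite mulr1; apply; rewrite -[X in is_derive _ _ _ X]add0r; exact: is_deriveD.
Qed.

(** The function [x |-> \int_0^T h (t + x) dt] is differentiated at [0] in two
ways: under the integral sign, where dominated convergence only needs a bounded
derivative, and as [P (T + x) - P x] for a primitive [P] of [h]. *)
Lemma bounded_FTC2 h (T M : R) : 0 < T -> (forall t, derivable h t 1) ->
  (forall t, `|derive1 h t| <= M) ->
  \int[mu]_(t in `[0, T]) derive1 h t = h T - h 0.
Proof.
move=> T0 dh hM.
have ch := derivable_continuous dh.
have cshift x : continuous (fun t => h (t + x)).
  move=> t; apply: continuous_comp; last exact: ch.
  by apply: (@cvgD _ R^o); [exact: cvg_id|exact: cvg_cst].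
(* A primitive beyond -2 serves for all translations by less than 1. *)
have [P dP] := continuous_primitive (-2) ch.
have dshift (t x : R) : is_derive x 1 (fun x => h (t + x)) (derive1 h (t + x)).
  apply: is_derive_translate; rewrite derive1E; exact: (derivableP (dh _)).
have d1 (x t : R) : partial1of2 (fun x t => h (t + x)) x t = derive1 h (t + x).
  by rewrite partial1of2E; apply: derive_val.
have M0 : 0 <= M by apply: le_trans (hM 0).
pose F x := \int[mu]_(t in `[0, T]) h (t + x).
have cvg1 : h^-1 *: (F (h + 0) - F 0) @[h --> 0^'] -->
   \int[mu]_(t in `[0, T]) derive1 h t.
  have -> : \int[mu]_(t in `[0, T]) derive1 h t =
    \int[mu]_(y in `[0, T]) partial1of2 (fun x t => h (t + x)) 0 y.
    by apply: eq_Rintegral => t _; rewrite d1 addr0.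
  apply: (@cvg_differentiation_under_integral R _ _ mu
    (fun x t => h (t + x)) `[0, T] (measurable_itv _) 0 (-1) 1 _ _ _ (cst M)).
  - by rewrite /= in_itv/= ltrN10 ltr01.
  - by move=> x _; exact: continuous_integrable.
  - by move=> x t _ _; apply: ex_derive.
  - by [].
  - by apply: continuous_integrable; exact: cst_continuous.
  - by move=> x t _ _; rewrite d1.
have Fx x : -1 < x < 1 -> F x = P (T + x) - P x.
  move=> /andP[x1 x2].
  have := @Rintegral_continuous_FTC2 (fun t => h (t + x)) (fun t => P (t + x))
    0 T T0 (cshift x).
  rewrite add0r; apply => t /andP[t0 tT]; rewrite addrC.
  under eq_fun do rewrite addrC.
  apply: is_derive_translate; apply: dP; lra.
have dPP : is_derive (0:R) 1 F (h T - h 0).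
  apply: (@near_eq_is_derive _ _ _ (fun x => P (T + x) - P x)).
  - by near=> x; rewrite Fx//; near: x; apply: near_in_itvoo; rewrite in_itv/= ltrN10 ltr01.
  - apply: is_deriveB.
    + by apply: is_derive_translate; rewrite addr0; apply: dP; lra.
    + by apply: dP; lra.
rewrite -(@derive_val _ _ _ _ _ _ _ dPP) -derive1E.
by apply/esym/cvg_lim.
Unshelve. all: by end_near.
Qed.

(** The derivative of [s |-> \int_0^T G s t dt] is the integral of [D s], which is
the [t]-derivative of a function with equal values at [0] and [T]. The partial
derivative [D] is only assumed bounded because it will involve the derivative
of a holomorphic function, whose continuity is a consequence of this lemma. *)
Lemma homotopy_Rintegral (G D : R -> R -> R) (u v T M : R) : 0 < T ->
  (forall s, u < s < v -> continuous (G s)) ->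
  (forall s t, u < s < v -> is_derive s (1:R) (G ^~ t) (D s t)) ->
  (forall s t, u < s < v -> `|D s t| <= M) ->
  (forall s, u < s < v -> exists2 H : R -> R, H T = H 0 &
     forall t, is_derive t (1:R) H (D s t)) ->
  forall s1 s2, u < s1 < v -> u < s2 < v ->
  \int[mu]_(t in `[0, T]) G s1 t = \int[mu]_(t in `[0, T]) G s2 t.
Proof.
move=> T0 cG dG DM DH.
pose F s := \int[mu]_(t in `[0, T]) G s t.
have d1 s t : u < s < v -> partial1of2 G s t = D s t.
  by move=> sI; rewrite partial1of2E; have := dG s t sI => ?; apply: derive_val.
have dF s : u < s < v -> is_derive s (1:R) F 0.
  move=> sI.
  have M0 : 0 <= M by apply: le_trans (DM s 0 sI).
  have sI' : s \in `]u, v[ by rewrite in_itv.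
  have I' x : `]u, v[%classic x -> u < x < v by rewrite /= in_itv.
  have cstM : mu.-integrable `[0, T] (EFin \o cst M).
    by apply: continuous_integrable; exact: cst_continuous.
  have iG x : `]u, v[%classic x -> mu.-integrable `[0, T] (EFin \o G x).
    by move=> /I' xI; apply: continuous_integrable; exact: cG.
  have dG' x t : `]u, v[%classic x -> `[0, T]%classic t -> derivable (G^~ t) x 1.
    by move=> /I' xI _; have := dG x t xI => ?; apply: ex_derive.
  have GM x t : `]u, v[%classic x -> `[0, T]%classic t -> `|partial1of2 G x t| <= cst M t.
    by move=> /I' xI _; rewrite d1//; exact: DM.
  have dv := @derivable_under_integral R _ _ mu G `[0, T] (measurable_itv _)
    s u v sI' iG dG' (cst M) (fun=> M0) cstM GM.
  have de := @differentiation_under_integral R _ _ mu G `[0, T] (measurable_itv _)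
    s u v sI' iG dG' (cst M) (fun=> M0) cstM GM.
  apply: DeriveDef => //; rewrite -derive1E de.
  have [H HT dH] := DH s sI.
  have dH' t : derive1 H t = D s t by rewrite derive1E; have := dH t => ?; apply: derive_val.
  rewrite (_ : \int[mu]_(t in _) _ = \int[mu]_(t in `[0, T]) derive1 H t); last first.
    by apply: eq_Rintegral => t _; rewrite dH' d1.
  have := @bounded_FTC2 H T M T0; rewrite HT subrr; apply.
  - by move=> t; have := dH t => ?; apply: ex_derive.
  - by move=> t; rewrite dH'; exact: DM.
have mono s1 s2 : s1 <= s2 -> u < s1 < v -> u < s2 < v -> F s1 = F s2.
  move=> s12 /andP[us1 s1v] /andP[us2 s2v].
  have [] := @MVT_segment R F (fun=> 0) s1 s2 s12.
  - by move=> x /[!in_itv]/= /andP[? ?]; apply: dF; lra.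
  - apply: derivable_within_continuous => x /[!in_itv]/= /andP[? ?].
    have xI : u < x < v by lra.
    by have := dF x xI => ?; apply: ex_derive.
  by move=> c _; rewrite mul0r => /eqP; rewrite subr_eq0 => /eqP.
move=> s1 s2 s1I s2I; rewrite -!/(F _).
by case: (leP s1 s2) => [|/ltW] /mono ->.
Qed.

End RealIntegral.

(** * Complex numbers, paths and derivatives *)

Section ComplexBasics.
Context {R : realType}.
Local Notation C := (Cplx R).
Implicit Types (x y : R) (z w : C).

Definition toC x : C := real_complex R x.
Definition re z : R := complex.Re z.
Definition im z : R := complex.Im z.
Definition ci : C := Complex 0 1.

HB.instance Definition _ := GRing.RMorphism.copy toC (real_complex R).

Lemma reB z w : re (z - w) = re z - re w. Proof. by case: z; case: w. Qed.
Lemma imB z w : im (z - w) = im z - im w. Proof. by case: z; case: w. Qed.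
Lemma reD z w : re (z + w) = re z + re w. Proof. by case: z; case: w. Qed.
Lemma imD z w : im (z + w) = im z + im w. Proof. by case: z; case: w. Qed.
Lemma reM z w : re (z * w) = re z * re w - im z * im w.
Proof. by case: z; case: w. Qed.
Lemma imM z w : im (z * w) = re z * im w + im z * re w.
Proof. by case: z; case: w. Qed.

Lemma reZ x z : re (toC x * z) = x * re z.
Proof. by case: z => p q /=; rewrite /re/= mul0r subr0. Qed.
Lemma imZ x z : im (toC x * z) = x * im z.
Proof. by case: z => p q /=; rewrite /im/= mul0r addr0. Qed.
Lemma ler_toC x y : (toC x <= toC y) = (x <= y). Proof. exact: lecR. Qed.
Lemma ltr_toC x y : (toC x < toC y) = (x < y). Proof. exact: ltcR. Qed.
Lemma toC_ge0 x : (0 <= toC x) = (0 <= x). Proof. exact: ler0c. Qed.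
Lemma toC_gt0 x : (0 < toC x) = (0 < x). Proof. exact: (ltcR 0). Qed.

Lemma norm_toC x : `|toC x| = toC `|x|.
Proof. by rewrite normc_def /= expr0n addr0 sqrtr_sqr. Qed.

Lemma normRe_le z : toC `|re z| <= `|z|.
Proof. exact: normc_ge_Re. Qed.

Lemma normIm_le z : toC `|im z| <= `|z|.
Proof.
rewrite normc_def lecR -sqrtr_sqr ler_sqrt; last by rewrite addr_ge0 ?sqr_ge0.
by rewrite lerDr sqr_ge0.
Qed.

Lemma cplxE z : z = toC (re z) + ci * toC (im z).
Proof. exact: complexE. Qed.

Lemma ci2 : ci * ci = -1 :> C.
Proof. by rewrite -expr2 /ci; exact: sqr_i. Qed.

Lemma norm_ci : `|ci| = 1.
Proof. by rewrite normc_def /= expr0n add0r expr1n sqrtr1. Qed.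

Lemma norm_le_ReIm z : `|z| <= toC (`|re z| + `|im z|).
Proof.
rewrite {1}[z]cplxE (le_trans (ler_normD _ _))// normrM norm_ci mul1r.
by rewrite !norm_toC -rmorphD.
Qed.

Lemma pos_toC z : 0 < z -> exists2 x, 0 < x & z = toC x.
Proof.
move=> z0; exists (re z); first by move: z0; rewrite ltcE/= => /andP[].
exact/esym/RRe_real/gtr0_real.
Qed.

Lemma norm_real z : exists2 x, 0 <= x & `|z| = toC x.
Proof. by rewrite normc_def; eexists; last reflexivity; exact: sqrtr_ge0. Qed.

(** Neighbourhoods in [Cplx R] are defined with radii in [Cplx R]; real radii allow
case analysis on their order. *)
Lemma near_toC z (P : set C) :
  (\forall w \near z, P w) <-> exists2 r, 0 < r & forall w, `|w - z| < toC r -> P w.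
Proof.
split.
  move=> /nbhs_ballP[e /= e0 eP]; have [r r0 er] := pos_toC e0.
  by exists r => // w wz; apply: eP; rewrite /ball/= distrC er.
move=> [r r0 rP]; apply/nbhs_ballP; exists (toC r) => /=; first by rewrite ltr_toC.
by move=> w; rewrite /ball/= distrC; exact: rP.
Qed.

Lemma nearI z (P Q : C -> Prop) : (\forall w \near z, P w) ->
  (\forall w \near z, Q w) -> \forall w \near z, P w /\ Q w.
Proof. exact: (@filterI _ _ (nbhs_filter z)). Qed.

Lemma dnbhsI z (P Q : C -> Prop) : (\forall w \near z^', P w) ->
  (\forall w \near z^', Q w) -> \forall w \near z^', P w /\ Q w.
Proof. have FD : Filter (nbhs z^') by exact _. exact: (@filterI _ _ FD). Qed.

Lemma dnbhs_ex z (P : C -> Prop) : (\forall w \near z^', P w) -> exists w, P w.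
Proof. have FD : ProperFilter (nbhs z^') by exact _. exact: (@filter_ex _ _ FD). Qed.

Lemma nbhs_dnbhs z (P : C -> Prop) : (\forall w \near z, P w) -> \forall w \near z^', P w.
Proof. by move=> zP; rewrite near_withinE; apply: filterS zP. Qed.

Lemma continuous_toC : continuous toC.
Proof.
move=> x; apply/cvgrPdist_lt => e /pos_toC[d d0 ->].
near=> y; rewrite -rmorphB norm_toC ltr_toC.
by near: y; apply/nbhs_ballP; exists d.
Unshelve. all: by end_near. Qed.

Lemma continuous_Re : continuous re.
Proof.
move=> z; apply/(cvgrPdist_lt (FF := nbhs_filter z)) => e e0.
apply/near_toC; exists e => // w we.
by rewrite distrC -ltr_toC -reB; apply: le_lt_trans (normRe_le _) _.
Qed.

Lemma continuous_Im : continuous im.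
Proof.
move=> z; apply/(cvgrPdist_lt (FF := nbhs_filter z)) => e e0.
apply/near_toC; exists e => // w we.
by rewrite distrC -ltr_toC -imB; apply: le_lt_trans (normIm_le _) _.
Qed.

(** [Cplx R] is a normed space over itself and not over [R], so the derivative of a
curve in the plane is not an instance of [derive]. *)
Definition path_derive (g : R -> C) (t : R) (d : C) : Prop :=
  (fun h : R => (toC h)^-1 * (g (h + t) - g t)) h @[h --> 0^'] --> d.

Lemma path_derive_Re g t d : path_derive g t d ->
  is_derive t (1:R) (re \o g) (re d).
Proof.
move=> gd.
have cv : h^-1 *: ((re \o g) (h *: 1 + t) - (re \o g) t) @[h --> 0^'] --> re d.
  apply: (cvg_trans _ (cvg_comp _ _ gd (@continuous_Re d))).
  apply: near_eq_cvg; near=> h.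
  by rewrite /= -fmorphV -reB [_ *: 1]mulr1 reZ.
by apply: DeriveDef; [apply/cvg_ex; exists (re d)|exact/cvg_lim].
Unshelve. all: by end_near. Qed.

Lemma path_derive_Im g t d : path_derive g t d ->
  is_derive t (1:R) (im \o g) (im d).
Proof.
move=> gd.
have cv : h^-1 *: ((im \o g) (h *: 1 + t) - (im \o g) t) @[h --> 0^'] --> im d.
  apply: (cvg_trans _ (cvg_comp _ _ gd (@continuous_Im d))).
  apply: near_eq_cvg; near=> h.
  by rewrite /= -fmorphV -imB [_ *: 1]mulr1 imZ.
by apply: DeriveDef; [apply/cvg_ex; exists (im d)|exact/cvg_lim].
Unshelve. all: by end_near. Qed.

Lemma path_derive_ReIm (p q : R -> R) t dp dq :
  is_derive t (1:R) p dp -> is_derive t (1:R) q dq ->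
  path_derive (fun t => toC (p t) + ci * toC (q t)) t (toC dp + ci * toC dq).
Proof.
move=> pd qd.
have dcv (f : R -> R) df : is_derive t (1:R) f df ->
    h^-1 * (f (h + t) - f t) @[h --> 0^'] --> df.
  move=> fd; have /cvg_ex[l fl] := @ex_derive _ _ _ _ _ _ _ fd.
  have := @derive_val _ _ _ _ _ _ _ fd.
  move/cvg_lim : (fl) => /= E; rewrite /derive E// => <-.
  apply: cvg_trans fl; apply: near_eq_cvg; near=> h.
  by rewrite [_ *: 1]mulr1.
have cp := cvg_comp _ _ (dcv _ _ pd) (@continuous_toC dp).
have cq := cvg_comp _ _ (dcv _ _ qd) (@continuous_toC dq).
apply: (cvg_trans _ (cvgD cp (cvgMl_tmp (a := ci) cq))).
apply: near_eq_cvg; near=> h.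
rewrite fctE /= !rmorphM !fmorphV !rmorphB; ring.
Unshelve. all: by end_near. Qed.

Lemma cvg_ReIm (T : Type) (F : set_system T) (FF : Filter F) (g : T -> C) z :
  re \o g @ F --> re z -> im \o g @ F --> im z -> g @ F --> z.
Proof.
move=> rg ig; rewrite [z]cplxE.
have -> : g = (fun t => toC (re (g t)) + ci * toC (im (g t))).
  by apply/funext => t; exact: cplxE.
have cr := cvg_comp _ _ rg (@continuous_toC (re z)).
have ccim := cvg_comp _ _ ig (@continuous_toC (im z)).
exact: (cvgD cr (cvgMl_tmp (a := ci) ccim)).
Qed.

Lemma path_derive_continuous g t d : path_derive g t d -> {for t, continuous g}.
Proof.
move=> gd; apply: cvg_ReIm.
- apply/differentiable_continuous/derivable1_diffP.
  by have ? := path_derive_Re gd; apply: ex_derive.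
- apply/differentiable_continuous/derivable1_diffP.
  by have ? := path_derive_Im gd; apply: ex_derive.
Qed.

(** Caratheodory's form of differentiability: [Q] is the difference quotient. It
turns the chain, product and quotient rules into algebra. *)
Lemma is_deriveP_slope (F : C -> C) (c d : C) :
  is_derive c 1 F d <->
  exists2 Q : C -> C, {for c, continuous Q} /\ Q c = d &
    \forall w \near c, F w = F c + (w - c) * Q w.
Proof.
split.
  move=> Fd; exists (fun w => if w == c then d else (F w - F c) / (w - c)).
    split; last by rewrite eqxx.
    apply/(cvgrPdist_lt (FF := nbhs_filter c)) => e e0; rewrite eqxx.
    have /cvg_ex[l Fl] := @ex_derive _ _ _ _ _ _ _ Fd.
    have := @derive_val _ _ _ _ _ _ _ Fd.
    move/cvg_lim : (Fl) => /= E; rewrite /derive E// => ld; subst l.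
    move/cvgrPdist_lt : Fl => /(_ e e0); rewrite near_withinE => /near_toC[r r0 rP].
    apply/near_toC; exists r => // w wr.
    case: eqP => [_|/eqP wc]; first by rewrite subrr normr0.
    have := rP (w - c); rewrite subr0 => /(_ wr).
    by rewrite subr_eq0 => /(_ wc); rewrite [_ *: 1]mulr1 /= subrK [_ *: _]mulrC.
  apply/near_toC; exists 1 => // w _.
  case: eqP => [->|/eqP wc]; first by rewrite subrr mul0r addr0.
  by rewrite mulrC divfK ?subr_eq0// addrC subrK.
move=> [Q [Qc Qd] FQ].
have cv : h^-1 *: (F (h *: 1 + c) - F c) @[h --> 0^'] --> d.
  apply/cvgrPdist_lt => e e0; rewrite near_withinE; apply/near_toC.
  move/(cvgrPdist_lt (FF := nbhs_filter c)) : Qc => /(_ e e0).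
  rewrite Qd => /(filterI FQ)/near_toC[r r0 rP]; exists r => // h.
  rewrite subr0 => hr h0; have := rP (h + c); rewrite addrK => /(_ hr)[Fhc].
  by rewrite [_ *: 1]mulr1 Fhc [F c + _]addrC !addrK [_ *: _]mulKf.
by apply: DeriveDef; [apply/cvg_ex; exists d|exact/cvg_lim].
Qed.

Lemma path_derive_comp (F : C -> C) (g : R -> C) t (d d' : C) :
  is_derive (g t) (1 : C) F d' -> path_derive g t d -> path_derive (F \o g) t (d' * d).
Proof.
move=> /is_deriveP_slope[Q [Qc Qd] FQ] gd.
have gt : g (h + t) @[h --> (0:R)^'] --> g t.
  apply: (@cvg_comp _ _ _ (fun h => h + t) g _ (nbhs t)).
    2: exact: path_derive_continuous gd.
  apply: cvg_within_filter.
  rewrite -{2}[t]add0r; apply: (@cvgD _ R^o); [exact: cvg_id|exact: cvg_cst].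
have := cvg_comp _ _ gt Qc.
rewrite Qd => Qg.
apply: (cvg_trans _ (cvgM Qg gd)); apply: near_eq_cvg.
near=> h; rewrite fctE /=.
have -> : F (g (h + t)) = F (g t) + (g (h + t) - g t) * Q (g (h + t)).
  by near: h; exact: (gt _ FQ).
ring.
Unshelve. all: by end_near. Qed.

End ComplexBasics.

(** * Integrals over a period *)

Section CircleIntegral.
Context {R : realType}.
Local Notation C := (Cplx R).
Implicit Types (x y r : R) (z w c k : C) (g : R -> C).
Local Notation mu := (@lebesgue_measure R).
Local Notation T := (2 * pi : R).

Definition period_int g : C :=
  toC (\int[mu]_(t in `[0, T]) re (g t)) + ci * toC (\int[mu]_(t in `[0, T]) im (g t)).

Lemma period_gt0 : 0 < T. Proof. by rewrite mulr_gt0// pi_gt0. Qed.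

Lemma continuous_re g : continuous g -> continuous (fun t => re (g t)).
Proof. by move=> cg t; apply: (cvg_comp _ _ (cg t)); exact: continuous_Re. Qed.

Lemma continuous_im g : continuous g -> continuous (fun t => im (g t)).
Proof. by move=> cg t; apply: (cvg_comp _ _ (cg t)); exact: continuous_Im. Qed.

Lemma period_intD g1 g2 : continuous g1 -> continuous g2 ->
  period_int (fun t => g1 t + g2 t) = period_int g1 + period_int g2.
Proof.
move=> c1 c2; rewrite /period_int.
have -> : \int[mu]_(t in `[0, T]) re (g1 t + g2 t) =
    \int[mu]_(t in `[0, T]) (re (g1 t) + re (g2 t)).
  by apply: eq_Rintegral => t _; rewrite reD.
have -> : \int[mu]_(t in `[0, T]) im (g1 t + g2 t) =
    \int[mu]_(t in `[0, T]) (im (g1 t) + im (g2 t)).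
  by apply: eq_Rintegral => t _; rewrite imD.
rewrite !RintegralD//; try (by apply: continuous_integrable;
  (exact: continuous_re || exact: continuous_im)).
by rewrite !rmorphD; ring.
Qed.

Lemma period_intZ k g : continuous g -> period_int (fun t => k * g t) = k * period_int g.
Proof.
move=> cg; rewrite /period_int.
have -> : \int[mu]_(t in `[0, T]) re (k * g t) =
    \int[mu]_(t in `[0, T]) (re k * re (g t) - im k * im (g t)).
  by apply: eq_Rintegral => t _; rewrite reM.
have -> : \int[mu]_(t in `[0, T]) im (k * g t) =
    \int[mu]_(t in `[0, T]) (re k * im (g t) + im k * re (g t)).
  by apply: eq_Rintegral => t _; rewrite imM.
have ir : mu.-integrable `[0, T] (EFin \o (fun t => re (g t))).
  exact/continuous_integrable/continuous_re.
have ii : mu.-integrable `[0, T] (EFin \o (fun t => im (g t))).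
  exact/continuous_integrable/continuous_im.
have iZ x (h : R -> R) : mu.-integrable `[0, T] (EFin \o h) ->
    mu.-integrable `[0, T] (EFin \o (fun t => x * h t)).
  by move=> ih; apply: eq_integrable (integrableZl _ x ih).
rewrite RintegralB ?RintegralD ?RintegralZl//; try exact: iZ.
rewrite [in RHS](cplxE k) !rmorphB !rmorphD !rmorphM/=.
ring: (@ci2 R).
Qed.

(** The factor [2] comes from bounding the real and imaginary parts separately. *)
Lemma period_int_bound g M : continuous g -> (forall t, 0 <= t <= T -> `|g t| <= toC M) ->
  `|period_int g| <= toC (2 * (T * M)).
Proof.
move=> cg gM.
have bnd (h : R -> R) : continuous h -> (forall t, 0 <= t <= T -> `|h t| <= M) ->
    `|\int[mu]_(t in `[0, T]) h t| <= T * M.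
  move=> ch hM; have ih := @continuous_integrable _ h 0 T ch.
  apply: le_trans (le_normr_Rintegral _ ih) _ => //.
  have -> : T * M = \int[mu]_(t in `[0, T]) cst M t.
    rewrite Rintegral_cst//= lebesgue_measure_itv /= lte_fin period_gt0/=.
    by rewrite oppr0 addr0 mulrC.
  apply: le_Rintegral => //.
  - by apply: continuous_integrable => t; apply: cvg_norm; exact: ch.
  - by apply: continuous_integrable; exact: cst_continuous.
rewrite /period_int (le_trans (ler_normD _ _))// normrM norm_ci mul1r !norm_toC.
rewrite -rmorphD ler_toC (_ : 2 * (T * M) = T * M + T * M); last by ring.
apply: lerD; apply: bnd.
- exact: continuous_re.
- by move=> t tT; rewrite -ler_toC; apply: le_trans (normRe_le _) (gM t tT).
- exact: continuous_im.
- by move=> t tT; rewrite -ler_toC; apply: le_trans (normIm_le _) (gM t tT).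
Qed.

Lemma period_int_cst k : period_int (fun=> k) = k * toC T.
Proof.
rewrite /period_int !Rintegral_cst//= lebesgue_measure_itv /= lte_fin period_gt0/=.
rewrite oppr0 addr0 !rmorphM [in RHS](cplxE k)/=; ring.
Qed.

Lemma homotopy_period_int (G D : R -> R -> C) (u v M : R) :
  (forall s, u < s < v -> continuous (G s)) ->
  (forall s t, u < s < v -> path_derive (G ^~ t) s (D s t)) ->
  (forall s t, u < s < v -> `|D s t| <= toC M) ->
  (forall s, u < s < v -> exists2 H : R -> C, H T = H 0 &
     forall t, path_derive H t (D s t)) ->
  forall s1 s2, u < s1 < v -> u < s2 < v -> period_int (G s1) = period_int (G s2).
Proof.
move=> cG dG DM DH s1 s2 s1I s2I; rewrite /period_int; congr (toC _ + _ * toC _).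
- apply: (@homotopy_Rintegral R (fun s t => re (G s t)) (fun s t => re (D s t))
    u v T M period_gt0) => //.
  + by move=> s sI; exact/continuous_re/cG.
  + by move=> s t sI; exact: (path_derive_Re (dG s t sI)).
  + by move=> s t sI; rewrite -ler_toC; apply: le_trans (normRe_le _) (DM s t sI).
  + move=> s sI; have [H HT dH] := DH s sI; exists (re \o H); first by rewrite /= HT.
    by move=> t; exact: path_derive_Re.
- apply: (@homotopy_Rintegral R (fun s t => im (G s t)) (fun s t => im (D s t))
    u v T M period_gt0) => //.
  + by move=> s sI; exact/continuous_im/cG.
  + by move=> s t sI; exact: (path_derive_Im (dG s t sI)).
  + by move=> s t sI; rewrite -ler_toC; apply: le_trans (normIm_le _) (DM s t sI).
  + move=> s sI; have [H HT dH] := DH s sI; exists (im \o H); first by rewrite /= HT.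
    by move=> t; exact: path_derive_Im.
Qed.

Lemma path_derive_affine w c s : path_derive (fun s : R => w + toC s * c) s c.
Proof.
apply: (cvg_trans _ (@cvg_cst _ c R ((0:R)^') _)); apply: near_eq_cvg.
near=> h; rewrite /= rmorphD.
have h0 : toC h != 0 by rewrite fmorph_eq0; near: h; exact: nbhs_dnbhs_neq.
by field.
Unshelve. all: by end_near. Qed.

Lemma path_derive_lin w k g t d : path_derive g t d ->
  path_derive (fun t => w + k * g t) t (k * d).
Proof.
move=> gd.
apply: (cvg_trans _ (cvgMl_tmp (a := k) gd)); apply: near_eq_cvg.
near=> h; rewrite /=; ring.
Unshelve. all: by end_near. Qed.

Lemma is_derive_inv_sub k b c : c != b ->
  is_derive c (1:C) (fun u => k / (u - b)) (- k / (c - b) ^+ 2).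
Proof.
rewrite -subr_eq0 => cb; apply/is_deriveP_slope.
exists (fun u => - k / ((c - b) * (u - b))).
  split; last by rewrite expr2.
  have cs : (u - b) @[u --> c] --> c - b.
    exact: (cvgB (cvg_id (F := nbhs c)) (@cvg_cst _ b C (nbhs c) (nbhs_filter c))).
  have {}cs := cvgMl_tmp (FF := nbhs_filter c) (a := c - b) cs.
  have cbb : (c - b) * (c - b) != 0 by rewrite mulf_neq0.
  have {}cs := cvgMl_tmp (FF := nbhs_filter c) (a := - k) (cvgV (FF := nbhs_filter c) cbb cs).
  exact: cs.
have [x x0 xE] := norm_real (c - b).
apply/near_toC; exists x.
  by rewrite -toC_gt0 -xE normr_gt0.
move=> w; rewrite -xE => wc.
have wb : w - b != 0.
  apply: contraTneq wc => /eqP; rewrite subr_eq0 => /eqP ->.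
  by rewrite distrC ltxx.
by field; rewrite cb wb.
Qed.

Definition cis (t : R) : C := toC (cos t) + ci * toC (sin t).

Lemma path_derive_cis t : path_derive cis t (ci * cis t).
Proof.
have -> : ci * cis t = toC (- sin t) + ci * toC (cos t).
  rewrite /cis rmorphN/=; ring: (@ci2 R).
exact: path_derive_ReIm.
Qed.

Lemma norm_cis t : `|cis t| = 1.
Proof.
have -> : cis t = Complex (cos t) (sin t).
  by apply/eqP; rewrite eq_complex /= !(mul0r,mulr0,mul1r,subr0,addr0,add0r) !eqxx.
by rewrite normc_def /= cos2Dsin2 sqrtr1.
Qed.

Lemma cis_periodic : cis T = cis 0.
Proof. by rewrite /cis mulr_natl cos2pi sin2pi cos0 sin0. Qed.

Definition circle (a : C) (r : R) (t : R) : C := a + toC r * cis t.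

Lemma path_derive_circle a r t : path_derive (circle a r) t (ci * (circle a r t - a)).
Proof.
have -> : ci * (circle a r t - a) = toC r * (ci * cis t) by rewrite /circle; ring.
exact/path_derive_lin/path_derive_cis.
Qed.

Lemma continuous_circle a r : continuous (circle a r).
Proof. by move=> t; exact: (path_derive_continuous (@path_derive_circle a r t)). Qed.

Lemma circle_periodic a r : circle a r T = circle a r 0.
Proof. by rewrite /circle cis_periodic. Qed.

Lemma norm_circle a r t : 0 <= r -> `|circle a r t - a| = toC r.
Proof. by move=> r0; rewrite /circle addrC addKr normrM norm_cis mulr1 norm_toC ger0_norm. Qed.

End CircleIntegral.

(** * Cauchy's formula on a circle *)

Section Cauchy.
Context {R : realType}.
Local Notation C := (Cplx R).
Implicit Types (x y r : R) (z w c k : C) (g psi : R -> C).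
Local Notation T := (2 * pi : R).

Lemma circle_dist_ge a r p w t : 0 <= r -> `|w - a| <= toC p ->
  toC (r - p) <= `|circle a r t - w|.
Proof.
move=> r0 wp; rewrite rmorphB/= lerBlDr -(norm_circle a t r0).
by apply: le_trans (ler_distD w _ _) _; rewrite lerD2l.
Qed.

Lemma circle_neq a r w t : `|w - a| < toC r -> circle a r t - w != 0.
Proof.
have [p p0 pE] := norm_real (w - a).
rewrite pE ltr_toC => pr; rewrite -normr_gt0.
apply: lt_le_trans (@circle_dist_ge a r p w t _ _); first by rewrite toC_gt0 subr_gt0.
- by rewrite ltW// (le_lt_trans p0).
- by rewrite pE.
Qed.

Lemma continuous_kernel a r psi w : continuous psi -> `|w - a| < toC r ->
  continuous (fun t => psi t / (circle a r t - w)).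
Proof.
move=> cpsi wr t; apply: cvgM; first exact: cpsi.
apply: cvgV; first exact: circle_neq.
by apply: cvgB; [exact: continuous_circle|exact: cvg_cst].
Qed.

Lemma continuous_circle_sub a r k : continuous (fun t => k * (circle a r t - a)).
Proof.
move=> t; apply: cvgMl_tmp; apply: cvgB; [exact: continuous_circle|exact: cvg_cst].
Qed.

(** Cauchy's formula for the constant [1]. Moving [w] to the center [a] along a
segment does not change the integral, and for [w = a] the integrand is
constant. *)
Lemma cauchy_index a r w : `|w - a| < toC r ->
  period_int (fun t => ci * (circle a r t - a) / (circle a r t - w)) = ci * toC T.
Proof.
have [x x0 xE] := norm_real (w - a); rewrite xE ltr_toC => xr.
have r0 : 0 < r by exact: le_lt_trans xr.
pose ws s := a + toC s * (w - a).
(* Chosen so that |s| <= 1 + e keeps the moving center within (r + x) / 2 of a. *)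
pose e := (r - x) / (2 * r).
have e0 : 0 < e by rewrite divr_gt0 ?subr_gt0 ?mulr_gt0.
pose p := (r + x) / 2.
have pr : p < r by rewrite /p; lra.
have wsp s : - e < s < 1 + e -> `|ws s - a| <= toC p.
  move=> sI; rewrite /ws addrC addKr normrM xE norm_toC -rmorphM ler_toC.
  have s1 : `|s| <= 1 + e by rewrite ler_norml; lra.
  apply: le_trans (ler_wpM2r x0 s1) _.
  have ex : e * x <= (r - x) / 2.
    have -> : (r - x) / 2 = e * r by rewrite /e; field; rewrite gt_eqF.
    by rewrite ler_pM2l// ltW.
  by rewrite mulrDl mul1r /p; lra.
have wsr s : - e < s < 1 + e -> `|ws s - a| < toC r.
  by move=> /wsp sI; apply: le_lt_trans sI _; rewrite ltr_toC.
pose G s t := ci * (circle a r t - a) / (circle a r t - ws s).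
pose D s t := ci * (circle a r t - a) * (w - a) / (circle a r t - ws s) ^+ 2.
have -> : (fun t => ci * (circle a r t - a) / (circle a r t - w)) = G 1.
  by apply/funext => t; rewrite /G /ws rmorph1 mul1r [a + _]addrC subrK.
have -> : ci * toC T = period_int (G 0).
  rewrite -period_int_cst; congr period_int; apply/funext => t.
  rewrite /G /ws rmorph0 mul0r addr0 mulfK//.
  by rewrite circle_neq// subrr normr0 toC_gt0.
apply: (@homotopy_period_int _ G D (- e) (1 + e) (r * x / ((r - p) ^+ 2))); last 2 first.
- by apply/andP; split; lra.
- by apply/andP; split; lra.
- by move=> s sI; apply: continuous_kernel; [exact: continuous_circle_sub|exact: wsr].
- move=> s t sI; pose k := ci * (circle a r t - a).
  have dF : is_derive (ws s) (1:C) (fun u => - k / (u - circle a r t))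
      (- - k / (ws s - circle a r t) ^+ 2).
    by apply: is_derive_inv_sub; rewrite eq_sym -subr_eq0 circle_neq// wsr.
  have := path_derive_comp dF (@path_derive_affine _ a (w - a) s).
  have -> : (fun u => - k / (u - circle a r t)) \o (fun s => a + toC s * (w - a)) = G^~ t.
    by apply/funext => u; rewrite /= /G -/(ws u) -/k -opprB invrN mulrN mulNr opprK.
  by congr (path_derive _ _ _); rewrite opprK -[_ - circle _ _ _]opprB sqrrN /D -/k mulrAC.
- move=> s t sI; rewrite /D !normrM norm_ci mul1r norm_circle ?(ltW r0)// xE normfV normrX.
  rewrite !rmorphM fmorphV rmorphXn ler_wpM2l ?mulr_ge0 ?toC_ge0 ?(ltW r0)//.
  rewrite lef_pV2 ?posrE ?exprn_gt0 ?normr_gt0 ?toC_gt0 ?subr_gt0 ?circle_neq ?wsr//.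
  apply: lerXn2r; rewrite ?nnegrE ?normr_ge0 ?toC_ge0 ?subr_ge0 ?(ltW pr)//.
  by apply: circle_dist_ge; [exact: ltW|exact: wsp].
- move=> s sI; exists ((fun u => - (w - a) / (u - ws s)) \o circle a r).
    by rewrite /= circle_periodic.
  move=> t.
  have dF : is_derive (circle a r t) (1:C) (fun u => - (w - a) / (u - ws s))
      (- - (w - a) / (circle a r t - ws s) ^+ 2).
    by apply: is_derive_inv_sub; rewrite -subr_eq0 circle_neq// wsr.
  have := path_derive_comp dF (@path_derive_circle _ a r t).
  congr (path_derive _ _ _); rewrite opprK /D; ring.
Qed.

(** The circle is contracted to [w] through [ga s t = w + s (zeta - w)], where
[zeta] is the point of parameter [t]. Since [ga s t - w = s (zeta - w)], the
kernel [zeta' / (zeta - w)] does not depend on [s], and the [s]-derivative of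
[F (ga s t) zeta' / (zeta - w)] is [F' (ga s t) zeta'], up to the factor [s] the
[t]-derivative of [F (ga s t)]. *)
Lemma cauchy_formula (F : C -> C) a r r0 L w : 0 < r -> r < r0 ->
  (forall w, `|w - a| < toC r0 -> derivable F w 1 /\ `|derive1 F w| <= toC L) ->
  `|w - a| < toC r ->
  F w * (ci * toC T) =
  period_int (fun t => F (circle a r t) * (ci * (circle a r t - a)) / (circle a r t - w)).
Proof.
move=> r_gt0 rr0 dF wr.
have r_ge0 := ltW r_gt0.
pose ga s t := w + toC s * (circle a r t - w).
(* Chosen so that (1 + 2 e) r = r0: the contraction stays in the larger disc
   for s slightly outside [0, 1], where s = 0 and s = 1 are interior points. *)
pose e := (r0 - r) / (2 * r).
have e0 : 0 < e by rewrite divr_gt0 ?subr_gt0 ?mulr_gt0.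
have gaE s t : ga s t - a = (1 - toC s) * (w - a) + toC s * (circle a r t - a).
  by rewrite /ga; ring.
have gar s t : - e < s < 1 + e -> `|ga s t - a| < toC r0.
  move=> sI; rewrite gaE; apply: le_lt_trans (ler_normD _ _) _.
  rewrite !normrM norm_circle// -(rmorph1 (@toC R)) -rmorphB !norm_toC.
  apply: (@le_lt_trans _ _ (toC (`|1 - s| * r + `|s| * r))).
    by rewrite rmorphD !rmorphM lerD2r ler_wpM2l ?toC_ge0// ltW.
  rewrite ltr_toC -mulrDl.
  have s1 : `|1 - s| + `|s| < 1 + 2 * e.
    by case: (ger0P s) => s0; case: (ger0P (1 - s)) => s1'; lra.
  have -> : r0 = (1 + 2 * e) * r by rewrite /e; field; rewrite gt_eqF.
  by rewrite ltr_pM2r.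
pose G s t := F (ga s t) * (ci * (circle a r t - a) / (circle a r t - w)).
pose D s t := derive1 F (ga s t) * (ci * (circle a r t - a)).
have dFga s t : - e < s < 1 + e -> is_derive (ga s t) (1:C) F (derive1 F (ga s t)).
  by move=> /gar -/(_ t) /dF[dFw _]; rewrite derive1E; exact: derivableP.
have dga s t : path_derive (ga s) t (toC s * (ci * (circle a r t - a))).
  have -> : ga s = (fun t => (w - toC s * w) + toC s * circle a r t).
    by apply/funext => u; rewrite /ga; ring.
  exact/path_derive_lin/path_derive_circle.
have -> : (fun t => F (circle a r t) * (ci * (circle a r t - a)) / (circle a r t - w)) = G 1.
  by apply/funext => t; rewrite /G /ga rmorph1 mul1r [w + _]addrC subrK -[LHS]mulrA.
have -> : F w * (ci * toC T) = period_int (G 0).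
  rewrite -(cauchy_index wr) -period_intZ; last first.
    by apply: continuous_kernel => //; exact: continuous_circle_sub.
  by congr period_int; apply/funext => t; rewrite /G /ga rmorph0 mul0r addr0.
apply/esym; apply: (@homotopy_period_int _ G D (- e) (1 + e) (L * r)); last 2 first.
- by apply/andP; split; lra.
- by apply/andP; split; lra.
- move=> s sI t; apply: cvgM.
    exact: (path_derive_continuous (path_derive_comp (dFga s t sI) (dga s t))).
  by apply: continuous_kernel => //; exact: continuous_circle_sub.
- move=> s t sI.
  have dgs : path_derive (ga^~ t) s (circle a r t - w) by exact: path_derive_affine.
  have := @path_derive_comp _ F (ga^~ t) s _ _ (dFga s t sI) dgs.
  pose k := ci * (circle a r t - a) / (circle a r t - w).
  move=> /(@path_derive_lin _ 0 k) dG.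
  have zw : circle a r t - w != 0 by exact: circle_neq.
  have -> : G^~ t = (fun s => 0 + k * (F \o ga^~ t) s).
    by apply/funext => u; rewrite /= add0r mulrC.
  have -> : D s t = k * (derive1 F (ga s t) * (circle a r t - w)); last exact: dG.
  by rewrite /D /k [RHS]mulrCA divfK.
- move=> s t sI; rewrite /D !normrM norm_ci mul1r norm_circle// rmorphM.
  by rewrite ler_wpM2r ?toC_ge0//; have [] := dF _ (gar s t sI).
(* The antiderivative is F (ga s t) / s; for s = 0, where ga is constant, it is
   a multiple of zeta. *)
- move=> s sI; have [s0|s0] := eqVneq s 0.
    exists (fun t => 0 + derive1 F w * circle a r t); first by rewrite circle_periodic.
    move=> t; have -> : D s t = derive1 F w * (ci * (circle a r t - a)).
      by rewrite /D /ga s0 rmorph0 mul0r addr0.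
    exact/path_derive_lin/path_derive_circle.
  exists (fun t => 0 + (toC s)^-1 * (F \o ga s) t).
    by rewrite /= /ga circle_periodic.
  move=> t; have -> : D s t = (toC s)^-1 *
      (derive1 F (ga s t) * (toC s * (ci * (circle a r t - a)))).
    by rewrite /D; field; rewrite fmorph_eq0.
  exact: (@path_derive_lin _ 0 _ _ _ _
    (@path_derive_comp _ F (ga s) t _ _ (dFga s t sI) (dga s t))).
Qed.

End Cauchy.

(** * Cauchy transforms and the order of a zero *)

Section CauchyTransform.
Context {R : realType}.
Local Notation C := (Cplx R).
Implicit Types (x y r M p : R) (z w c k : C) (psi : R -> C) (F : C -> C).
Local Notation T := (2 * pi : R).

Lemma continuous_path_bounded psi : continuous psi ->
  exists2 M, 0 <= M & forall t, 0 <= t <= T -> `|psi t| <= toC M.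
Proof.
move=> cpsi.
have cre := continuous_re cpsi; have cim := continuous_im cpsi.
have bnd (h : R -> R) : continuous h -> exists M, forall t, 0 <= t <= T -> `|h t| <= M.
  move=> ch; have cn : {within `[0, T], continuous (fun t => `|h t|)}.
    by apply: continuous_subspaceT => t; apply: cvg_norm; exact: ch.
  have [c _ cM] := EVT_max (ltW (@period_gt0 R)) cn.
  by exists `|h c| => t tT; apply: cM; rewrite in_itv.
have [M1 HM1] := bnd _ cre; have [M2 HM2] := bnd _ cim.
exists (M1 + M2).
  rewrite addr_ge0//; [apply: le_trans (HM1 0 _)|apply: le_trans (HM2 0 _)] => //;
  by rewrite lexx ltW// period_gt0.
move=> t tT; apply: le_trans (norm_le_ReIm _) _.
by rewrite ler_toC lerD ?HM1 ?HM2.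
Qed.

Definition cauchy_transform (a : C) r psi w :=
  period_int (fun t => psi t / (circle a r t - w)).

(** The resolvent identity for the kernel [1 / (zeta - w)]. With [w] fixed it says
that a Cauchy transform minus its value at [w] is divisible by [w' - w] with a
Cauchy transform as quotient. *)
Lemma cauchy_transform_step a r psi w w' : continuous psi ->
  `|w - a| < toC r -> `|w' - a| < toC r ->
  cauchy_transform a r psi w' =
  cauchy_transform a r psi w +
  (w' - w) * cauchy_transform a r (fun t => psi t / (circle a r t - w)) w'.
Proof.
move=> cpsi wr w'r.
have ck := continuous_kernel cpsi wr.
have ck' := continuous_kernel ck w'r.
pose g1 t := psi t / (circle a r t - w).
pose g2 t := g1 t / (circle a r t - w').
have ckk : continuous (fun t => (w' - w) * g2 t).
  by move=> t; apply: cvgMl_tmp; exact: ck'.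
rewrite /cauchy_transform -(period_intZ (g := g2) (w' - w) ck')
  -(period_intD (g1 := g1) ck ckk).
congr period_int; apply/funext => t; rewrite /g2 /g1.
by field; rewrite !circle_neq.
Qed.

Lemma cauchy_transform_bound a r p M psi w : continuous psi ->
  (forall t, 0 <= t <= T -> `|psi t| <= toC M) -> 0 < r -> p < r ->
  `|w - a| <= toC p ->
  `|cauchy_transform a r psi w| <= toC (2 * (T * (M / (r - p)))).
Proof.
move=> cpsi psiM r0 pr wp.
have wr : `|w - a| < toC r by apply: le_lt_trans wp _; rewrite ltr_toC.
apply: period_int_bound; first exact: continuous_kernel.
move=> t tT; rewrite normrM normfV rmorphM fmorphV ler_pM ?psiM//.
rewrite lef_pV2 ?posrE ?normr_gt0 ?circle_neq ?toC_gt0 ?subr_gt0//.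
by apply: circle_dist_ge => //; exact: ltW.
Qed.

Lemma between_radius a r w : `|w - a| < toC r ->
  exists2 p, `|w - a| < toC p & p < r.
Proof.
have [x x0 ->] := norm_real (w - a); rewrite ltr_toC => xr.
by exists ((x + r) / 2); rewrite ?ltr_toC; lra.
Qed.

Lemma radius_gt0 a r w : `|w - a| < toC r -> 0 < r.
Proof. by move=> wr; rewrite -toC_gt0; apply: le_lt_trans wr. Qed.

Lemma near_dist a p w : `|w - a| < toC p -> \forall w' \near w, `|w' - a| < toC p.
Proof.
have [x x0 xE] := norm_real (w - a); rewrite xE ltr_toC => xp.
apply/near_toC; exists (p - x); first by rewrite subr_gt0.
move=> w' w'w; have -> : w' - a = (w' - w) + (w - a) by rewrite addrA subrK.
apply: le_lt_trans (ler_normD _ _) _; rewrite xE -ltrBrDr.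
by apply: lt_le_trans w'w _; rewrite rmorphB.
Qed.

Lemma continuous_cauchy_transform a r psi w : continuous psi -> `|w - a| < toC r ->
  {for w, continuous (cauchy_transform a r psi)}.
Proof.
move=> cpsi wr; have [p wp pr] := between_radius wr.
have r0 := radius_gt0 wr.
have ck := continuous_kernel cpsi wr.
have [M M0 HM] := continuous_path_bounded ck.
pose B := 2 * (T * (M / (r - p))) + 1.
have B0 : 0 < B.
  have : 0 <= M / (r - p) by rewrite divr_ge0// subr_ge0 ltW.
  by move=> /(mulr_ge0 (ltW (@period_gt0 R))); rewrite /B; lra.
apply/(cvgrPdist_lt (FF := nbhs_filter w)) => _ /pos_toC[e e0 ->].
have eB : 0 < e / B by rewrite divr_gt0.
have n1 := near_dist wp.
have n2 : \forall w' \near w, `|w' - w| < toC (e / B).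
  by apply/near_toC; exists (e / B).
apply: (filterS2 _ _ n1 n2) => w' w'p w'e.
have w'r : `|w' - a| < toC r by apply: lt_trans w'p _; rewrite ltr_toC.
rewrite distrC (cauchy_transform_step cpsi wr w'r) addrC addKr normrM.
have HB := cauchy_transform_bound ck HM r0 pr (ltW w'p).
have -> : toC e = toC (e / B) * toC B by rewrite -rmorphM divfK// gt_eqF.
apply: le_lt_trans (_ : _ <= `|w' - w| * toC B) _.
  apply: ler_wpM2l => //; apply: le_trans HB _.
  by rewrite ler_toC /B lerDl.
by rewrite ltr_pM2r ?toC_gt0.
Qed.

(** By [cauchy_transform_step] the difference quotient at [w] is itself a Cauchy
transform, hence continuous. *)
Lemma is_derive_cauchy_transform a r psi w : continuous psi -> `|w - a| < toC r ->
  is_derive w (1:C) (cauchy_transform a r psi)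
    (cauchy_transform a r (fun t => psi t / (circle a r t - w)) w).
Proof.
move=> cpsi wr; apply/is_deriveP_slope.
exists (cauchy_transform a r (fun t => psi t / (circle a r t - w))).
  split; last by reflexivity.
  exact: continuous_cauchy_transform (continuous_kernel cpsi wr) wr.
apply: (filterS _ (near_dist wr)) => w' w'r; exact: cauchy_transform_step.
Qed.

(** Holomorphic near [a] with a locally bounded derivative, the form in which
holomorphy follows from a bound on the spherical derivative and in which
[cauchy_formula] uses it. *)
Definition regular F (a : C) := exists L : C,
  \forall w \near a, derivable F w 1 /\ `|derive1 F w| <= L.

Lemma regular_cauchy_transform a r psi : 0 < r -> continuous psi ->
  regular (cauchy_transform a r psi) a.
Proof.
move=> r0 cpsi; have [M M0 HM] := continuous_path_bounded cpsi.
exists (toC (2 * (T * (M / (r - r / 2) / (r - r / 2))))).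
apply/near_toC; exists (r / 2); first by rewrite divr_gt0.
move=> w wr2.
have wr : `|w - a| < toC r by apply: lt_trans wr2 _; rewrite ltr_toC; lra.
have dK := is_derive_cauchy_transform cpsi wr; split; first exact: ex_derive.
have dv := @derive_val _ _ _ _ _ _ _ dK; rewrite derive1E dv.
have kM t : 0 <= t <= T ->
    `|psi t / (circle a r t - w)| <= toC (M / (r - r / 2)).
  move=> tT; rewrite normrM normfV rmorphM fmorphV; apply: ler_pM; rewrite ?invr_ge0//.
    exact: HM.
  rewrite lef_pV2 ?posrE ?normr_gt0 ?toC_gt0; [|exact: circle_neq|lra].
  by apply: circle_dist_ge; exact: ltW.
have r2 : r / 2 < r by lra.
exact: (cauchy_transform_bound (continuous_kernel cpsi wr) kM r0 r2 (ltW wr2)).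
Qed.

Lemma regular_is_cauchy_transform F a : regular F a ->
  exists r psi, [/\ 0 < r, continuous psi &
    forall w, `|w - a| < toC r -> F w = cauchy_transform a r psi w].
Proof.
move=> [L /near_toC[r0 r00 FL]].
have L0 : 0 <= L.
  have aa : `|a - a| < toC r0 by rewrite subrr normr0 toC_gt0.
  by have [_] := FL a aa; exact: le_trans.
have [l _ lE] := norm_real L; rewrite ger0_norm// in lE; subst L.
pose r := r0 / 2.
have r_gt0 : 0 < r by rewrite divr_gt0.
have rr0 : r < r0 by rewrite /r; lra.
pose k : C := ci * toC T.
have k0 : k != 0.
  apply: mulf_neq0; first by rewrite -normr_gt0 norm_ci ltr01.
  by rewrite fmorph_eq0 gt_eqF// period_gt0.
have cpsi : continuous (fun t => F (circle a r t) * (ci * (circle a r t - a))).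
  move=> t; apply: cvgM; last exact: continuous_circle_sub.
  have cF : {for circle a r t, continuous F}.
    apply/differentiable_continuous/derivable1_diffP.
    by apply: (FL _ _).1; rewrite norm_circle ?ltW// ltr_toC.
  exact: (cvg_comp _ _ (@continuous_circle _ a r t) cF).
exists r, (fun t => k^-1 * (F (circle a r t) * (ci * (circle a r t - a)))).
split; first exact: r_gt0.
  by move=> t; apply: cvgMl_tmp; exact: cpsi.
move=> w wr; have := cauchy_formula r_gt0 rr0 FL wr; rewrite -/k => FE.
have -> : F w = k^-1 * (F w * k) by rewrite mulrC mulfK.
rewrite FE -period_intZ; last exact: continuous_kernel.
by congr period_int; apply/funext => t; rewrite mulrA.
Qed.

(** Iterating [cauchy_transform_step] at the center divides the density by
[(zeta - a)^n]; the value at [a] of the resulting transform is the [n]-th Taylor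
coefficient. *)
Definition density (a : C) r psi n t := psi t / (circle a r t - a) ^+ n.

Lemma density0 a r psi : density a r psi 0 = psi.
Proof. by apply/funext => t; rewrite /density expr0 divr1. Qed.

Lemma densityS a r psi n :
  density a r psi n.+1 = fun t => density a r psi n t / (circle a r t - a).
Proof. by apply/funext => t; rewrite /density -mulrA -invfM -exprSr. Qed.

Lemma center_in_disc (a : C) r : 0 < r -> `|a - a| < toC r.
Proof. by move=> r0; rewrite subrr normr0 toC_gt0. Qed.

Lemma continuous_density a r psi n : 0 < r -> continuous psi ->
  continuous (density a r psi n).
Proof.
move=> r0 cpsi; elim: n => [|n IH]; first by rewrite density0; exact: cpsi.
by rewrite densityS; exact: continuous_kernel IH (center_in_disc a r0).
Qed.

(** By induction: the [i]-th coefficient is the constant term that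
[cauchy_transform_step] splits off at stage [i]. *)
Lemma cauchy_transform_factor a r psi n w : 0 < r -> continuous psi -> `|w - a| < toC r ->
  (forall i, (i < n)%N -> cauchy_transform a r (density a r psi i) a = 0) ->
  cauchy_transform a r psi w = (w - a) ^+ n * cauchy_transform a r (density a r psi n) w.
Proof.
move=> r0 cpsi wr; elim: n => [_|n IH K0].
  by rewrite expr0 mul1r density0.
rewrite IH; last by move=> i iln; apply: K0; exact: ltnW.
have := cauchy_transform_step (@continuous_density a r psi n r0 cpsi) (center_in_disc a r0)
  wr.
by rewrite (K0 n (ltnSn n)) add0r -densityS exprSr => ->; rewrite mulrA.
Qed.

Lemma geometric_squeeze (y q c : R) : 0 <= q < 1 ->
  (forall n, y <= q ^+ n * c) -> y <= 0.
Proof.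
move=> /andP[q0 q1] yq.
have cv : q ^+ n * c @[n --> \oo] --> (0 : R).
  rewrite -[X in _ --> X](mul0r c); apply: cvgMr_tmp; apply: cvg_expr.
  by rewrite ger0_norm.
by apply: (@ler_cvg_to _ _ _ _ (fun=> y) _ y 0 (@cvg_cst _ y _ _ _) cv); exact: nearW.
Qed.

(** If some Taylor coefficient is nonzero, the first such gives the factorization.
If all vanish, [cauchy_transform_factor] and [cauchy_transform_bound] bound
[|F w|] by a constant times [(|w - a| / r)^n] for every [n]. *)
Lemma regular_order F a : regular F a ->
  (\forall w \near a, F w = 0) \/
  exists n Q, [/\ regular Q a, Q a != 0 &
    \forall w \near a, F w = (w - a) ^+ n * Q w].
Proof.
move=> /regular_is_cauchy_transform[r [psi [r0 cpsi FE]]].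
have [[n0 Kn0]|K0] := pselect (exists n, cauchy_transform a r (density a r psi n) a != 0).
  have [n Kn nmin] := ex_minnP
    (ex_intro (fun n => cauchy_transform a r (density a r psi n) a != 0) n0 Kn0).
  right; exists n, (cauchy_transform a r (density a r psi n)); split.
  - exact: (@regular_cauchy_transform a r _ r0 (@continuous_density a r psi n r0 cpsi)).
  - exact: Kn.
  - apply/near_toC; exists r => // w wr; rewrite FE//.
    apply: cauchy_transform_factor => // i il; apply/eqP; apply: contraTT il => /nmin.
    by rewrite -leqNgt.
left; apply/near_toC; exists r => // w wr.
have {}K0 n : cauchy_transform a r (density a r psi n) a = 0.
  by apply/eqP; apply: contra_notT K0 => Kn; exists n.
have [p wp pr] := between_radius wr.
have p0 : 0 <= p by rewrite -toC_ge0; apply: le_trans (ltW wp).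
have [M M0 HM] := continuous_path_bounded cpsi.
have [y y0 yE] := norm_real (F w).
suff : y <= 0.
  move=> y0'; apply/eqP; rewrite -normr_eq0 yE.
  by rewrite (_ : y = 0) ?rmorph0//; apply/eqP; rewrite eq_le y0 y0'.
apply: (@geometric_squeeze y (p / r) (2 * (T * (M / (r - p))))).
  by rewrite divr_ge0 ?(ltW r0)// ltr_pdivrMr// mul1r.
move=> n; rewrite -ler_toC -yE FE// (@cauchy_transform_factor a r psi n w)//.
rewrite normrM normrX.
have kM t : 0 <= t <= T -> `|density a r psi n t| <= toC (M / r ^+ n).
  move=> tT; rewrite /density normrM normfV normrX norm_circle ?(ltW r0)//.
  by rewrite rmorphM fmorphV rmorphXn ler_wpM2r ?invr_ge0 ?exprn_ge0 ?toC_ge0 ?(ltW r0)// HM.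
have := cauchy_transform_bound (@continuous_density a r psi n r0 cpsi) kM r0 pr (ltW wp).
have -> : (p / r) ^+ n * (2 * (T * (M / (r - p)))) =
  p ^+ n * (2 * (T * (M / r ^+ n / (r - p)))) by rewrite expr_div_n; ring.
rewrite [toC (p ^+ n * _)]rmorphM rmorphXn; apply: ler_pM => //.
change (`|w - a| ^+ n <= toC p ^+ n).
apply: lerXn2r.
- by rewrite nnegrE.
- by rewrite nnegrE toC_ge0.
- exact: ltW.
Qed.

End CauchyTransform.

(** * Topology of the plane and of the sphere *)

Section SphereTopology.
Context {R : realType}.
Local Notation C := (Cplx R).
Local Notation P1 := (P1 R).
Implicit Types (x y r M p : R) (z w c k : C).

Lemma norm_le_real (z : C) : exists2 M, 0 <= M & `|z| <= toC M.
Proof. by have [x x0 ->] := norm_real z; exists x. Qed.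

(** Stated for arbitrary functions, as it serves both for the identity, to bound a
compact set, and for the spherical derivative. *)
Lemma compact_locally_bounded (K : set C) (h : C -> C) : compact K ->
  (forall z, K z -> exists M, \forall w \near z, `|h w| <= toC M) ->
  exists M, forall z, K z -> `|h z| <= toC M.
Proof.
move=> /compact_near_coveringP cK hK.
have := cK R (pinfty_nbhs R) (fun M z => `|h z| <= toC M) _ _.
move=> /(_ _)[].
  move=> z Kz; have [M hM] := hK z Kz.
  exists ([set w | `|h w| <= toC M], [set M' | M < M']).
    by split => //; exists M; split => //; exact: num_real.
  move=> [w M'] [/= hw MM']; apply: le_trans hw _.
  by rewrite ler_toC ltW.
move=> M [_ HM]; exists (M + 1) => z Kz; apply: HM => //.
by rewrite ltrDl.
Qed.

Lemma closed_disc M : closed [set z : C | `|z| <= toC M].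
Proof.
have -> : [set z : C | `|z| <= toC M] = (fun z => re `|z|) @^-1` [set x | x <= M].
  have E z : (`|z| <= toC M) = (re `|z| <= M).
    by have [x _ ->] := norm_real z; rewrite ler_toC.
  by apply/seteqP; split => z; rewrite /preimage /mkset E.
apply: closed_comp; last exact: closed_le.
move=> z _; have cn : `|w| @[w --> z] --> `|z| by exact: (@norm_continuous C C z).
exact: (cvg_comp _ _ cn (@continuous_Re _ `|z|)).
Qed.

Lemma compact_disc M : compact [set z : C | `|z| <= toC M].
Proof.
pose f (u : R * R) : C := toC u.1 + ci * toC u.2.
have cf : continuous f.
  move=> u; apply: cvg_ReIm.
  - have ref : re \o f = fst.
      apply/funext => v; change (re (f v) = v.1).
      by rewrite /f reD reM /re /im/= !(mul0r,mulr0,mul1r,subr0,addr0,add0r).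
    rewrite -[re (f u)]/((re \o f) u) ref; exact: cvg_fst.
  - have imf : im \o f = snd.
      apply/funext => v; change (im (f v) = v.2).
      by rewrite /f imD imM /re /im/= !(mul0r,mulr0,mul1r,subr0,addr0,add0r).
    rewrite -[im (f u)]/((im \o f) u) imf; exact: cvg_snd.
have cI := compact_setX (@segment_compact R (- M) M) (@segment_compact R (- M) M).
have cfI := continuous_compact (continuous_subspaceT cf) cI.
apply: (subclosed_compact _ cfI).
  exact: closed_disc.
move=> z /= zM; exists (re z, im z); last by rewrite /f/= -cplxE.
split; rewrite /= in_itv/= -ler_norml -ler_toC.
- exact: le_trans (normRe_le _) zM.
- exact: le_trans (normIm_le _) zM.
Qed.

Lemma locally_compact_C : locally_compact [set: C].
Proof.
move=> z _; have [M M0 zM] := norm_le_real z.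
have z1 : `|z - 0| < toC (M + 1).
  by rewrite subr0; apply: le_lt_trans zM _; rewrite ltr_toC ltrDl.
exists [set z : C | `|z| <= toC (M + 1)].
  by rewrite withinET; apply: filterS (near_dist z1) => w /=; rewrite subr0 => /ltW.
split; [exact: compact_disc|exact: closed_disc].
Qed.

Lemma hausdorff_P1 : hausdorff_space P1.
Proof.
apply: one_point_compactification_hausdorff; first exact: locally_compact_C.
exact: (@norm_hausdorff C C).
Qed.

(** Compact sets of the plane are bounded, so convergence to the added point of the
compactification is divergence of the modulus. *)
Lemma cvg_infty (T : Type) (F : set_system T) (FF : Filter F) (g : T -> P1) :
  (forall M, \forall t \near F, forall a, g t = fin a -> toC M < `|a|) ->
  g @ F --> (infty : P1).
Proof.
move=> gM U [K [cK _] KU].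
have [M HM] : exists M, forall z, K z -> `|z| <= toC M.
  apply: (@compact_locally_bounded K id) => // z _.
  have [M M0 zM] := norm_le_real z; exists (M + 1).
  have z1 : `|z - 0| < toC (M + 1).
    by rewrite subr0; apply: le_lt_trans zM _; rewrite ltr_toC ltrDl.
  by apply: filterS (near_dist z1) => w /=; rewrite subr0 => /ltW.
apply: filterS (gM M) => t /= gt; apply: KU.
case E: (g t) => [a|]; last by right.
left; exists a => // Ka; have := gt a E.
by have := HM a Ka => /le_lt_trans/[apply]; rewrite ltxx.
Qed.

Lemma near_neq (f : C -> P1) z (x : P1) : {for z, continuous f} -> f z <> x ->
  \forall w \near z, f w <> x.
Proof.
move=> cf fz.
have cx : closed [set x] by apply/accessible_closed_set1/hausdorff_accessible/hausdorff_P1.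
have : nbhs (f z) (~` [set x]).
  by apply: open_nbhs_nbhs; split; [exact: closed_openC|].
by move=> /cf.
Qed.

Lemma near_near z (P : C -> Prop) : (\forall w \near z, P w) ->
  \forall w \near z, \forall u \near w, P u.
Proof.
move=> /near_toC[r r0 rP].
have zz : `|z - z| < toC r by rewrite subrr normr0 toC_gt0.
apply: filterS (near_dist zz) => w wr.
by apply: filterS (near_dist wr) => u; exact: rP.
Qed.

(** A punctured neighbourhood of [z] is a neighbourhood of each of its points. *)
Lemma near_dnbhs z (P : C -> Prop) : (\forall w \near z^', P w) ->
  \forall w \near z, \forall u \near w^', P u.
Proof.
rewrite near_withinE => /near_toC[r r0 rP].
have zz : `|z - z| < toC r by rewrite subrr normr0 toC_gt0.
apply: filterS (near_dist zz) => w wr; rewrite near_withinE.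
have [wz|wz] := eqVneq w z.
  by apply: filterS (near_dist wr) => u ur; rewrite wz; exact: rP.
have wz' : `|w - z| != 0 by rewrite normr_eq0 subr_eq0.
have [x x0 xE] := norm_real (w - z).
have xgt : 0 < x by rewrite -toC_gt0 -xE lt0r wz' normr_ge0.
have nz : \forall u \near w, u != z.
  apply/near_toC; exists x => // u uw; apply: contraTneq uw => ->.
  by rewrite distrC xE ltxx.
by apply: filterS2 (near_dist wr) nz => u ur uz _; exact: rP.
Qed.

End SphereTopology.

(** * Quotients of holomorphic functions *)

Section Quotients.
Context {R : realType}.
Local Notation C := (Cplx R).
Local Notation P1 := (P1 R).
Implicit Types (x y r M p : R) (z w c k a b : C) (A B F : C -> C).

Lemma continuous_locally_bounded F z : {for z, continuous F} ->
  exists M, \forall w \near z, `|F w| <= toC M.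
Proof.
move=> cF; have [M M0 zM] := norm_le_real (F z); exists (M + 1).
move/(cvgrPdist_lt (FF := nbhs_filter z)) : cF => /(_ 1 ltr01).
apply: filterS => w wz; rewrite rmorphD rmorph1.
have -> : F w = F z - (F z - F w) by rewrite opprB addrC subrK.
by apply: le_trans (ler_normB _ _) _; apply: lerD => //; exact: ltW.
Qed.

Lemma continuous_near_neq0 F z : {for z, continuous F} -> F z != 0 ->
  \forall w \near z, F w != 0.
Proof.
move=> cF Fz; have Fz0 : 0 < `|F z| by rewrite normr_gt0.
move/(cvgrPdist_lt (FF := nbhs_filter z)) : cF => /(_ _ Fz0).
by apply: filterS => w; apply: contraTneq => ->; rewrite subr0 ltxx.
Qed.

Lemma is_derive_continuous F z k : is_derive z (1:C) F k -> {for z, continuous F}.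
Proof.
move=> dF; apply/differentiable_continuous/derivable1_diffP.
exact: (@ex_derive _ _ _ _ _ _ _ dF).
Qed.

Lemma is_derive_mul A B z a b : is_derive z (1:C) A a -> is_derive z (1:C) B b ->
  is_derive z (1:C) (fun w => A w * B w) (a * B z + A z * b).
Proof.
move=> dA dB; have := @is_deriveM _ _ A B z 1 a b dA dB.
by rewrite addrC [B z *: _]mulrC.
Qed.

Lemma is_derive_div A B z a b : is_derive z (1:C) A a -> is_derive z (1:C) B b ->
  B z != 0 ->
  is_derive z (1:C) (fun w => A w / B w) ((a * B z - A z * b) / B z ^+ 2).
Proof.
move=> dA dB Bz.
have cB := is_derive_continuous dB.
move/is_deriveP_slope : dA => [P [cP Pz] AP].
move/is_deriveP_slope : dB => [Q [cQ Qz] BQ].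
apply/is_deriveP_slope.
exists (fun w => (P w * B z - A z * Q w) / (B z * B w)).
  split; last by rewrite Pz Qz expr2.
  have c1 := cvgB (FF := nbhs_filter z) (cvgMr_tmp (FF := nbhs_filter z) (b := B z) cP)
     (cvgMl_tmp (FF := nbhs_filter z) (a := A z) cQ).
  have BB : B z * B z != 0 by rewrite mulf_neq0.
  have c2 := cvgV (FF := nbhs_filter z) BB (cvgMl_tmp (FF := nbhs_filter z) (a := B z) cB).
  have c3 := cvgM (FF := nbhs_filter z) c1 c2.
  exact: c3.
have nB := continuous_near_neq0 cB Bz.
apply: filterS (filterI AP (filterI BQ nB)) => w [Aw [Bw Bw0]].
have E : A w * B z - A z * B w = (w - z) * (P w * B z - A z * Q w) by rewrite Aw Bw; ring.
have -> : A w / B w = A z / B z + (A w * B z - A z * B w) / (B z * B w).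
  by field; rewrite Bz Bw0.
by rewrite E mulrA.
Qed.

Lemma is_derive_horner (p : {poly C}) z : is_derive z (1:C) (horner p) p^`().[z].
Proof.
elim/poly_ind: p => [|p c IH].
  rewrite deriv0 horner0 (_ : horner 0 = cst 0); first exact: is_derive_cst.
  by apply/funext => w; rewrite horner0.
have -> : horner (p * 'X + c%:P) = (fun w => p.[w] * w) + cst c.
  by apply/funext => w; rewrite !hornerE fctE.
have -> : (p * 'X + c%:P)^`().[z] = (p^`().[z] * z + p.[z] * 1) + 0.
  by rewrite derivD derivC derivM derivX !hornerE.
apply: is_deriveD; apply: is_derive_mul => //; exact: is_derive_id.
Qed.

Lemma is_derive_of_bound F z L : derivable F z 1 /\ `|derive1 F z| <= L ->
  is_derive z (1:C) F (derive1 F z).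
Proof. by move=> [dF _]; rewrite derive1E; exact: derivableP. Qed.

Lemma regular_is_derive F z : regular F z -> is_derive z (1:C) F (derive1 F z).
Proof. by move=> [L /nbhs_singleton]; exact: is_derive_of_bound. Qed.

Lemma regular_near F z : regular F z -> \forall w \near z, regular F w.
Proof. by move=> [L /near_near FL]; apply: filterS FL => w; exists L. Qed.

Lemma regularE F z : regular F z <-> exists (G : C -> C) L,
  \forall w \near z, is_derive w (1:C) F (G w) /\ `|G w| <= L.
Proof.
split=> [[L FL]|[G [L GL]]].
  exists (derive1 F), L; apply: filterS FL => w FL; split; last exact: FL.2.
  exact: is_derive_of_bound FL.
exists L; apply: filterS GL => w [dw]; rewrite derive1E.
have -> := @derive_val _ _ _ _ _ _ _ dw; split => //.
Qed.

Lemma norm_le_toC z L : `|z| <= L -> exists2 x, 0 <= x & L = toC x.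
Proof.
move=> zL; have L0 : 0 <= L by exact: le_trans zL.
by have [x x0] := norm_real L; rewrite ger0_norm//; exists x.
Qed.

Lemma regularM A B z : regular A z -> regular B z -> regular (fun w => A w * B w) z.
Proof.
move=> rA rB.
have [MA bA] := continuous_locally_bounded (is_derive_continuous (regular_is_derive rA)).
have [MB bB] := continuous_locally_bounded (is_derive_continuous (regular_is_derive rB)).
have [LA nA] := rA; have [LB nB] := rB.
apply/regularE; exists (fun w => derive1 A w * B w + A w * derive1 B w).
exists (LA * toC MB + toC MA * LB).
have n1 := nearI bA bB.
have n2 := nearI nA nB.
apply: (filterS (Filter := nbhs_filter z) _ (nearI n1 n2)) => w [[Aw Bw] [dA dB]]; split.
  exact: is_derive_mul (is_derive_of_bound dA) (is_derive_of_bound dB).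
apply: le_trans (ler_normD _ _) _; rewrite !normrM.
by apply: lerD; apply: ler_pM => //; [exact: dA.2|exact: dB.2].
Qed.

Lemma regular_horner (p : {poly C}) z : regular (horner p) z.
Proof.
have [M bM] := continuous_locally_bounded (is_derive_continuous (is_derive_horner p^`() z)).
apply/regularE; exists (horner p^`()), (toC M).
by apply: filterS bM => w pw; split => //; exact: is_derive_horner.
Qed.

Lemma regular_cst k z : regular (fun=> k) z.
Proof.
have -> : (fun=> k) = horner k%:P by apply/funext => w; rewrite hornerC.
exact: regular_horner.
Qed.

Lemma regular_expB n z a : regular (fun w => (w - a) ^+ n) z.
Proof.
have -> : (fun w => (w - a) ^+ n) = horner (('X - a%:P) ^+ n).
  by apply/funext => w; rewrite horner_exp hornerXsubC.
exact: regular_horner.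
Qed.

(** The point of homogeneous coordinates [a : b]. *)
Definition quo a b : P1 := if b == 0 then infty else fin (a / b).

Lemma chart0_quo a b : chart0 (quo a b) = a / b.
Proof. by rewrite /quo; case: eqP => //= ->; rewrite invr0 mulr0. Qed.

Lemma chart_infty_quo a b : chart_infty (quo a b) = b / a.
Proof. by rewrite /quo; case: eqP => /= [->|_]; rewrite ?mul0r// invf_div. Qed.

Lemma quo_scale c a b : c != 0 -> quo (c * a) (c * b) = quo a b.
Proof.
move=> c0; rewrite /quo mulf_eq0 (negPf c0) /=; case: eqP => // /eqP b0.
by congr fin; field; rewrite c0 b0.
Qed.

Lemma quo_neq_infty a b : quo a b <> infty -> b != 0.
Proof. by rewrite /quo; case: eqP. Qed.

Lemma quo_neq0 a b : quo a b <> fin 0 -> a != 0 \/ b = 0.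
Proof.
rewrite /quo; case: eqP => [->|/eqP b0 ab]; first by right.
by left; apply: contra_notN ab => /eqP ->; rewrite mul0r.
Qed.

(** Where [B] vanishes, [A] does not, and [A / B] tends to infinity because [B / A]
tends to [0]. *)
Lemma continuous_quo A B z : {for z, continuous A} -> {for z, continuous B} ->
  A z != 0 \/ B z != 0 -> {for z, continuous (fun w => quo (A w) (B w))}.
Proof.
move=> cA cB AB.
have [Bz|Bz] := eqVneq (B z) 0; last first.
  have n := continuous_near_neq0 cB Bz.
  have c : (fin (A w / B w) : P1) @[w --> z] --> (fin (A z / B z) : P1).
    apply: (cvg_comp _ _ (cvgM (FF := nbhs_filter z) cA (cvgV (FF := nbhs_filter z) Bz cB))).
    exact: one_point_compactification_some_continuous.
  have qz : quo (A z) (B z) = fin (A z / B z) by rewrite /quo (negPf Bz).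
  rewrite /prop_for /continuous_at /= qz.
  have E : \forall w \near z, (fin (A w / B w) : P1) = quo (A w) (B w).
    by apply: filterS n => w Bw; rewrite /quo (negPf Bw).
  exact: (cvg_trans (near_eq_cvg E) c).
case: AB => [Az|]; last by rewrite Bz eqxx.
have qz : quo (A z) (B z) = infty by rewrite /quo Bz eqxx.
rewrite /prop_for /continuous_at /= qz.
apply: (@cvg_infty _ _ _ (nbhs_filter z)) => M.
have cBA : B w / A w @[w --> z] --> B z / A z.
  exact: (cvgM (FF := nbhs_filter z) cB (cvgV (FF := nbhs_filter z) Az cA)).
have e0 : 0 < toC (`|M| + 1)^-1 :> C by rewrite toC_gt0 invr_gt0 ltr_wpDl.
move/(cvgrPdist_lt (FF := nbhs_filter z)) : cBA => /(_ _ e0) n2.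
have n := continuous_near_neq0 cA Az.
apply: filterS (filterI n n2) => w [Aw]; rewrite Bz mul0r sub0r normrN => BA a.
rewrite /quo; case: eqP => // /eqP Bw [<-].
apply: (@le_lt_trans _ _ (toC `|M|)); first by rewrite ler_toC ler_norm.
apply: (@lt_trans _ _ (toC (`|M| + 1))); first by rewrite ltr_toC ltrDl.
rewrite -[A w / B w]invf_div normfV -[toC _]invrK -fmorphV.
by rewrite ltf_pV2 ?posrE// normr_gt0 mulf_neq0// invr_neq0.
Qed.

Section Local.
Variables (f : C -> P1) (A B : C -> C) (z a b : C).
Hypothesis fE : \forall w \near z, f w = quo (A w) (B w).
Hypothesis dA : is_derive z (1:C) A a.
Hypothesis dB : is_derive z (1:C) B b.

Lemma is_derive_chart0 : B z != 0 ->
  is_derive z (1:C) (chart0 \o f) ((a * B z - A z * b) / B z ^+ 2).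
Proof.
move=> Bz; apply: (@near_eq_is_derive _ _ _ (fun w => A w / B w)).
  by apply: filterS fE => w /= ->; rewrite chart0_quo.
exact: is_derive_div.
Qed.

Lemma is_derive_chart_infty : A z != 0 ->
  is_derive z (1:C) (chart_infty \o f) ((b * A z - B z * a) / A z ^+ 2).
Proof.
move=> Az; apply: (@near_eq_is_derive _ _ _ (fun w => B w / A w)).
  by apply: filterS fE => w /= ->; rewrite chart_infty_quo.
exact: is_derive_div.
Qed.

(** The expression is unchanged when [A] and [B] are exchanged, so it does not
depend on the chart in which the spherical derivative is computed. *)
Lemma spherical_derivative_quo : A z != 0 \/ B z != 0 ->
  spherical_derivative f z = `|a * B z - A z * b| / (`|A z| ^+ 2 + `|B z| ^+ 2).
Proof.
move=> AB; have fz := nbhs_singleton fE.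
have formula (x y n : C) : y != 0 -> `|n / y ^+ 2| / (1 + `|x / y| ^+ 2) =
    `|n| / (`|x| ^+ 2 + `|y| ^+ 2).
  move=> y0; rewrite !normrM !normfV !normrX.
  have y0' : `|y| != 0 by rewrite normr_eq0.
  have s0 : `|x| ^+ 2 + `|y| ^+ 2 != 0.
    by rewrite gt_eqF// ltr_wpDl ?exprn_ge0// exprn_gt0// normr_gt0.
  by field; rewrite y0' s0.
rewrite /spherical_derivative; have [Bz|Bz] := eqVneq (B z) 0.
  have Az : A z != 0 by case: AB => //; rewrite Bz eqxx.
  have fzE : f z = None by rewrite fz /quo Bz eqxx.
  have dh := is_derive_chart_infty Az; rewrite fzE /= derive1E.
  have -> := @derive_val _ _ _ _ _ _ _ dh.
  rewrite fz chart_infty_quo formula// [`|B z| ^+ 2 + _]addrC.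
  have -> : b * A z - B z * a = - (a * B z - A z * b) by ring.
  by rewrite normrN.
have fzE : f z = Some (A z / B z) by rewrite fz /quo (negPf Bz).
have dh := is_derive_chart0 Bz; rewrite fzE /= derive1E.
have -> := @derive_val _ _ _ _ _ _ _ dh.
by rewrite fz chart0_quo formula.
Qed.

End Local.

End Quotients.

(** * Meromorphic maps and their products *)

Section Meromorphic.
Context {R : realType}.
Local Notation C := (Cplx R).
Local Notation P1 := (P1 R).
Implicit Types (x y M K : R) (z w c k a b : C) (A B F : C -> C) (f r : C -> P1).
Implicit Types (p q : {poly C}).

Lemma brodyP f : brody f <-> exists K, forall z, `|spherical_derivative f z| <= toC K.
Proof.
split=> [[M [Mr HM]]|[K HK]].
  have M1 : M < M + 1 by rewrite ltrDl.
  have HM1 z : `|spherical_derivative f z| <= M + 1 by exact: HM M1 z I.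
  have [K K0 KE] := norm_le_toC (HM1 0).
  by exists K => z; rewrite -KE.
exists (toC K); split.
  by apply/complex_realP; exists K.
by move=> x Kx z _; apply: le_trans (HK z) (ltW Kx).
Qed.

Lemma bounded_chart_derivative (h d : C) K M :
  `|d| / (1 + `|h| ^+ 2) <= toC K -> `|h| <= toC M -> `|d| <= toC K * (1 + toC M ^+ 2).
Proof.
move=> dK hM.
have h1 : 0 < 1 + `|h| ^+ 2 by rewrite ltr_pwDl// exprn_ge0.
have K0 : 0 <= toC K by apply: le_trans dK; rewrite divr_ge0// ltW.
rewrite ler_pdivrMr// in dK; apply: le_trans dK _.
apply: ler_wpM2l => //; rewrite lerD2l; apply: lerXn2r => //; rewrite nnegrE//.
exact: le_trans hM.
Qed.

Lemma derivable_continuous_at F z : derivable F z 1 -> {for z, continuous F}.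
Proof. by move=> dF; apply/differentiable_continuous/derivable1_diffP. Qed.

Lemma regular_chart0 f z : holomorphic_map f -> brody f -> f z <> infty ->
  regular (chart0 \o f) z /\
  \forall w \near z, f w = quo (chart0 (f w)) 1.
Proof.
move=> [cf df0 _] /brodyP[K HK] fz.
have nf := near_neq (cf z) fz.
have [M bM] := continuous_locally_bounded (derivable_continuous_at (df0 z fz)).
split.
  exists (toC K * (1 + toC M ^+ 2)).
  apply: (filterS (Filter := nbhs_filter z) _ (nearI nf bM)).
  move=> w [fw hw]; split; first exact: df0.
  apply: bounded_chart_derivative hw; apply: le_trans (HK w).
  rewrite /spherical_derivative; case E : (f w) fw => [v|] // _.
  by rewrite /= E /= normrM normr_id normfV [`|1 + _|]ger0_norm// addr_ge0// exprn_ge0.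
apply: filterS nf => w; case: (f w) => [v|] // _.
by rewrite /quo oner_eq0 divr1.
Qed.

Lemma quo1_chart_infty (u : P1) : u <> fin 0 -> u = quo 1 (chart_infty u).
Proof.
rewrite /quo; case: u => [v|] /=; last by rewrite eqxx.
case: (eqVneq v 0) => [->//|v0 _].
by rewrite invr_eq0 (negPf v0) div1r invrK.
Qed.

Lemma regular_chart_infty f z : holomorphic_map f -> brody f -> f z <> fin 0 ->
  regular (chart_infty \o f) z /\
  \forall w \near z, f w = quo 1 (chart_infty (f w)).
Proof.
move=> [cf _ df1] /brodyP[K HK] fz.
have nf := near_neq (cf z) fz.
have [M bM] := continuous_locally_bounded (derivable_continuous_at (df1 z fz)).
have fE : \forall w \near z, f w = quo 1 (chart_infty (f w)).
  by apply: filterS nf => w; exact: quo1_chart_infty.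
split=> //; exists (toC K * (1 + toC M ^+ 2)).
have nfE := near_near fE.
apply: (filterS (Filter := nbhs_filter z) _ (nearI nf
  (nearI bM nfE))).
move=> w [fw [hw fwE]]; have dw := df1 w fw; split; first exact: dw.
apply: bounded_chart_derivative hw; apply: le_trans (HK w).
have dh : is_derive w (1:C) (chart_infty \o f) (derive1 (chart_infty \o f) w).
  by rewrite derive1E; exact: derivableP.
have -> := @spherical_derivative_quo _ f (fun=> 1) (chart_infty \o f) w 0 _ fwE
  (is_derive_cst (1:C) w 1) dh (or_introl (oner_neq0 _)).
rewrite mul0r sub0r mul1r normrN normr1 expr1n.
by rewrite normrM normr_id normfV [`|1 + _|]ger0_norm// addr_ge0// exprn_ge0.
Qed.

Lemma regular_isolated_zero F z : regular F z ->
  (\forall w \near z, F w = 0) \/ (\forall w \near z^', F w != 0).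
Proof.
move=> /regular_order[|[n [Q [rQ Qz FE]]]]; first by left.
right; rewrite near_withinE.
have nQ := continuous_near_neq0 (is_derive_continuous (regular_is_derive rQ)) Qz.
apply: (filterS (Filter := nbhs_filter z) _ (nearI FE nQ)).
move=> w [-> Qw] wz; apply: mulf_neq0 => //; rewrite expf_eq0 negb_and.
by rewrite subr_eq0 wz orbT.
Qed.

Lemma segment_path_continuous z0 z1 : continuous (fun t : R => z0 + toC t * (z1 - z0)).
Proof.
by move=> t; exact: (path_derive_continuous (@path_derive_affine R z0 (z1 - z0) t)).
Qed.

(** Along a segment a nonempty clopen set pulls back to a clopen subset of the
line. *)
Lemma connected_C (U : set C) : U !=set0 -> open U -> closed U -> forall z, U z.
Proof.
move=> [z0 Uz0] oU cU z1.
pose g t := z0 + toC t * (z1 - z0).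
have cg : continuous g by exact: segment_path_continuous.
have cR : connected [set: R] by apply/connected_intervalP.
have : g @^-1` U = [set: R].
  apply: cR.
  - by exists 0; rewrite /preimage /mkset /g rmorph0 mul0r addr0.
  - exists (g @^-1` U); last by rewrite setTI.
    by apply: open_comp => // t _; exact: cg.
  - exists (g @^-1` U); last by rewrite setTI.
    by apply: closed_comp => // t _; exact: cg.
move=> gU; have : (g @^-1` U) 1 by rewrite gU.
by rewrite /preimage /mkset /g rmorph1 mul1r addrC subrK.
Qed.

(** The set of points near which [f] is infinite is open. At a point of its closure
[f] is infinite and [1 / f] has a zero that is not isolated, so [1 / f] vanishes
nearby; hence the set is closed, and it is not the whole plane. *)
Lemma not_locally_infty f z : meromorphic f -> brody f ->
  ~ \forall w \near z, f w = infty.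
Proof.
move=> [hf [z1 fz1]] bf nz; have [cf _ _] := hf.
pose U : set C := [set z | \forall w \near z, f w = infty].
suff /(_ z1)/nbhs_singleton : forall z, U z by [].
apply: connected_C; first by exists z.
  by rewrite openE => w Uw; exact: near_near.
move=> w clw.
have fw : f w = infty.
  apply: contrapT => fw.
  by have [u [Uu]] := clw _ (near_neq (cf w) fw); apply; exact: nbhs_singleton Uu.
have fw0 : f w <> fin 0 by rewrite fw.
have [rB fE] := regular_chart_infty hf bf fw0.
have [B0|Bn] := regular_isolated_zero rB.
  apply: filterS (filterI fE B0) => u [-> /= ->].
  by rewrite /quo eqxx.
have := Bn; rewrite near_withinE => Bn'.
have [u [Uu [Bu fu]]] := clw _ (filterI Bn' fE).
have [uw|uw] := eqVneq u w; first by rewrite -uw.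
have Bu0 : (chart_infty \o f) u = 0 by rewrite /= (nbhs_singleton Uu).
have /eqP Bu1 := Bu uw; exfalso; exact: (Bu1 Bu0).
Qed.

(** The isolated zeros of [B] make the map finite on a punctured neighbourhood of
[z], where products can be computed pointwise. *)
Definition quotient_at f z := exists A B, [/\ regular A z, regular B z,
  A z != 0 \/ B z != 0, (\forall w \near z^', B w != 0) &
  \forall w \near z, f w = quo (A w) (B w)].

Lemma brody_quotient_at f z : meromorphic f -> brody f -> quotient_at f z.
Proof.
move=> mf bf; have [hf _] := mf.
have [fz|fz] := pselect (f z = infty).
  have fz0 : f z <> fin 0 by rewrite fz.
  have [rB fE] := regular_chart_infty hf bf fz0.
  exists (fun=> 1), (chart_infty \o f); split; last exact: fE.
  - exact: regular_cst.
  - exact: rB.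
  - by left; exact: oner_neq0.
  - have [B0|Bn] := regular_isolated_zero rB; last exact: Bn.
    case: (not_locally_infty mf bf (z := z)).
    apply: filterS (filterI fE B0) => u [-> /= ->].
    by rewrite /quo eqxx.
have [rA fE] := regular_chart0 hf bf fz.
exists (chart0 \o f), (fun=> 1); split; last exact: fE.
- exact: rA.
- exact: regular_cst.
- by right; exact: oner_neq0.
- by rewrite near_withinE; apply/near_toC; exists 1 => // w _ _; exact: oner_neq0.
Qed.

Lemma regular_neq0_near A B z : regular A z -> regular B z ->
  A z != 0 \/ B z != 0 -> \forall w \near z, A w != 0 \/ B w != 0.
Proof.
move=> rA rB [n|n].
- have := continuous_near_neq0 (is_derive_continuous (regular_is_derive rA)) n.
  by apply: filterS => w; left.
- have := continuous_near_neq0 (is_derive_continuous (regular_is_derive rB)) n.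
  by apply: filterS => w; right.
Qed.

(** The coordinates need only be correct off [z]: [A : B] is continuous at every
point near [z], so its value there is the limit that defines the product. *)
Lemma mero_mul_near r f A B z : regular A z -> regular B z ->
  A z != 0 \/ B z != 0 ->
  (\forall w \near z^', mul_off_poles (r w) (f w) = quo (A w) (B w)) ->
  \forall w \near z, mero_mul r f w = quo (A w) (B w).
Proof.
move=> rA rB AB E.
have nA := regular_near rA; have nB := regular_near rB.
have nAB := regular_neq0_near rA rB AB; have nE := near_dnbhs E.
apply: (filterS (Filter := nbhs_filter z) _ (nearI
  (nearI nA nB) (nearI nAB nE))).
move=> w [[rAw rBw] [ABw Ew]].
have cq := continuous_quo (is_derive_continuous (regular_is_derive rAw))
  (is_derive_continuous (regular_is_derive rBw)) ABw.
apply: cvg_lim; first exact: hausdorff_P1.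
have Ew' : \forall u \near w^', quo (A u) (B u) = mul_off_poles (r u) (f u).
  by apply: filterS Ew => u ->.
have cq' : quo (A u) (B u) @[u --> w^'] --> quo (A w) (B w).
  move=> V qV; change (\forall u \near w^', V (quo (A u) (B u))).
  have nV : \forall u \near w, V (quo (A u) (B u)) by exact: (cq V qV).
  by rewrite near_withinE; apply: filterS nV.
exact: (cvg_trans (near_eq_cvg Ew') cq').
Qed.

Lemma quo_divide_powers m n (d a b : C) : d != 0 ->
  quo (d ^+ m * a) (d ^+ n * b) = quo (d ^+ (m - n) * a) (d ^+ (n - m) * b).
Proof.
move=> d0; rewrite -[RHS](quo_scale (c := d ^+ minn m n)) ?expf_neq0//.
have Em : (minn m n + (m - n) = m)%N by rewrite minnE subnK// leq_subr.
have En : (minn m n + (n - m) = n)%N by rewrite minnC minnE subnK// leq_subr.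
by rewrite !mulrA -!exprD Em En.
Qed.

(** Both coordinates are a power of [w - z] times a nonvanishing function, and the
common power can be removed. If [A] vanishes near [z], the map is [0 : 1]. *)
Lemma cancel_common_zeros A B z : regular A z -> regular B z ->
  (\forall w \near z^', B w != 0) ->
  exists A' B', [/\ regular A' z, regular B' z, A' z != 0 \/ B' z != 0,
   (\forall w \near z^', B' w != 0) &
   \forall w \near z^', quo (A w) (B w) = quo (A' w) (B' w)].
Proof.
move=> rA rB nB.
have [A0|[m [A1 [rA1 A1z AE]]]] := regular_order rA.
  exists (fun=> 0), (fun=> 1); split; try exact: regular_cst.
  - by right; exact: oner_neq0.
  - by rewrite near_withinE; apply/near_toC; exists 1 => // w _ _; exact: oner_neq0.
  - have nA : \forall w \near z^', A w = 0 by exact: nbhs_dnbhs.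
    apply: filterS (dnbhsI nA nB) => w [-> Bw].
    by rewrite /quo (negPf Bw) oner_eq0 !mul0r.
have [B0|[n [B1 [rB1 B1z BE]]]] := regular_order rB.
  have nB0 : \forall w \near z^', B w = 0 by exact: nbhs_dnbhs.
  have /dnbhs_ex[w [Bw]] := dnbhsI nB nB0.
  by move=> Bw0; rewrite Bw0 eqxx in Bw.
have rA' := regularM (@regular_expB _ (m - n) z z) rA1.
have rB' := regularM (@regular_expB _ (n - m) z z) rB1.
exists (fun w => (w - z) ^+ (m - n) * A1 w), (fun w => (w - z) ^+ (n - m) * B1 w).
have E : \forall w \near z^',
    quo (A w) (B w) = quo ((w - z) ^+ (m - n) * A1 w) ((w - z) ^+ (n - m) * B1 w).
  rewrite near_withinE; apply: (filterS (Filter := nbhs_filter z) _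
    (nearI AE BE)) => w [-> ->] wz.
  by apply: quo_divide_powers; rewrite subr_eq0.
split=> //.
- have [mn|nm] := leqP m n.
    by left; rewrite (eqP mn) expr0 mul1r.
  by right; rewrite (eqP (ltnW nm)) expr0 mul1r.
- have [B0|//] := regular_isolated_zero rB'.
  have nB0 : \forall w \near z^', (w - z) ^+ (n - m) * B1 w = 0.
    exact: nbhs_dnbhs.
  have /dnbhs_ex[w [Bw [Bw0 Ew]]] := dnbhsI nB (dnbhsI nB0 E).
  by move: Ew; rewrite Bw0 /quo (negPf Bw) eqxx.
Qed.

Lemma horner_isolated_zero q z : q != 0 -> \forall w \near z^', q.[w] != 0.
Proof.
move=> q0; have [n [q1]] := multiplicity_XsubC q z.
rewrite q0 /= => q1z qE.
have c1 := is_derive_continuous (is_derive_horner q1 z).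
have n1 := continuous_near_neq0 c1 q1z.
rewrite near_withinE; apply: filterS n1 => w q1w wz.
rewrite qE hornerM horner_exp hornerXsubC mulf_neq0// expf_neq0//.
by rewrite subr_eq0.
Qed.

Lemma mul_off_poles_quo p q r f A B z : q != 0 -> (forall w, r w = quo p.[w] q.[w]) ->
  (\forall w \near z^', B w != 0) -> (\forall w \near z, f w = quo (A w) (B w)) ->
  \forall w \near z^', mul_off_poles (r w) (f w) = quo (p.[w] * A w) (q.[w] * B w).
Proof.
move=> q0 rE nB fE.
have nq := horner_isolated_zero z q0.
apply: filterS (dnbhsI (dnbhsI nq nB) (nbhs_dnbhs fE)) => w [[qw Bw] fw].
rewrite rE fw /quo (negPf qw) (negPf Bw) mulf_eq0 (negPf qw) (negPf Bw) /=.
by congr fin; rewrite invfM; ring.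
Qed.

Lemma quotient_at_mul p q r f z : q != 0 -> (forall w, r w = quo p.[w] q.[w]) ->
  quotient_at f z -> quotient_at (mero_mul r f) z.
Proof.
move=> q0 rE [A [B [rA rB AB nB fE]]].
have rN := regularM (regular_horner p z) rA.
have rD := regularM (regular_horner q z) rB.
have nq := horner_isolated_zero z q0.
have nD : \forall w \near z^', q.[w] * B w != 0.
  by apply: filterS (dnbhsI nq nB) => w [qw Bw]; exact: mulf_neq0.
have [A' [B' [rA' rB' AB' nB' E]]] := cancel_common_zeros rN rD nD.
exists A', B'; split => //.
apply: mero_mul_near => //.
by apply: filterS (dnbhsI (mul_off_poles_quo q0 rE nB fE) E) => w [-> ->].
Qed.

Lemma quotient_at_meromorphic f : (forall z, quotient_at f z) -> meromorphic f.
Proof.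
move=> mf; split; last first.
  have [A [B [_ _ _ nB fE]]] := mf 0.
  have fE' : \forall w \near 0^', f w = quo (A w) (B w) by exact: nbhs_dnbhs.
  have /dnbhs_ex[w [Bw fw]] := dnbhsI nB fE'.
  by exists w; rewrite fw /quo (negPf Bw).
have loc z : exists A B a b, [/\ is_derive z (1:C) A a, is_derive z (1:C) B b,
    A z != 0 \/ B z != 0 & \forall w \near z, f w = quo (A w) (B w)].
  have [A [B [rA rB AB _ fE]]] := mf z.
  exists A, B, (derive1 A z), (derive1 B z); split; last exact: fE.
  - exact: regular_is_derive rA.
  - exact: regular_is_derive rB.
  - exact: AB.
split=> [z|z fz|z fz]; have [A [B [a [b [dA dB AB fE]]]]] := loc z.
- have cq := continuous_quo (is_derive_continuous dA) (is_derive_continuous dB) AB.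
  rewrite /continuous_at (nbhs_singleton fE).
  have fE' : \forall w \near z, quo (A w) (B w) = f w by apply: filterS fE => w ->.
  exact: (cvg_trans (near_eq_cvg fE') cq).
- have Bz : B z != 0 by apply: (@quo_neq_infty _ (A z) (B z)); rewrite -(nbhs_singleton fE).
  by have dh := is_derive_chart0 fE dA dB Bz; exact: (@ex_derive _ _ _ _ _ _ _ dh).
- have Az : A z != 0.
    have := @quo_neq0 _ (A z) (B z); rewrite -(nbhs_singleton fE) => /(_ fz)[//|Bz].
    by case: AB => //; rewrite Bz eqxx.
  by have dh := is_derive_chart_infty fE dA dB Az; exact: (@ex_derive _ _ _ _ _ _ _ dh).
Qed.

Lemma quotient_at_locally_bounded f z : quotient_at f z ->
  exists M, \forall w \near z, `|spherical_derivative f w| <= toC M.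
Proof.
move=> [A [B [rA rB AB _ fE]]].
have cA := is_derive_continuous (regular_is_derive rA).
have cB := is_derive_continuous (regular_is_derive rB).
have [MA bA] := continuous_locally_bounded cA.
have [MB bB] := continuous_locally_bounded cB.
have [MN bN] : exists M, \forall w \near z, `|(`|A w| ^+ 2 + `|B w| ^+ 2)^-1| <= toC M.
  apply: continuous_locally_bounded.
  have cn F : {for z, continuous F} -> {for z, continuous (fun w => `|F w| ^+ 2 : C)}.
    move=> cF; have cnF : (`|F w| : C) @[w --> z] --> (`|F z| : C).
      exact: (cvg_comp _ _ cF (@norm_continuous C C (F z))).
    have cM := cvgM (FF := nbhs_filter z) cnF cnF.
    by rewrite /prop_for /continuous_at /= expr2; exact: cM.
  have N0 : `|A z| ^+ 2 + `|B z| ^+ 2 != 0.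
    rewrite paddr_eq0 ?exprn_ge0// !expf_eq0/= !normr_eq0 negb_and.
    by case: AB => ->; rewrite ?orbT.
  exact: (cvgV (FF := nbhs_filter z) N0 (cvgD (FF := nbhs_filter z) (cn _ cA) (cn _ cB))).
have [LA nA] := rA; have [LB nB] := rB.
have nAB := regular_neq0_near rA rB AB; have nE := near_near fE.
have [lA lA0 lAE] := norm_le_toC (nbhs_singleton nA).2.
have [lB lB0 lBE] := norm_le_toC (nbhs_singleton nB).2.
subst LA LB.
exists ((lA * MB + MA * lB) * MN).
apply: (filterS (Filter := nbhs_filter z) _ (nearI (nearI bA bB)
  (nearI (nearI bN nAB) (nearI nE (nearI nA nB))))).
move=> w [[Aw Bw] [[Nw ABw] [Ew [dAw dBw]]]].
have -> := spherical_derivative_quo Ew (is_derive_of_bound dAw) (is_derive_of_bound dBw) ABw.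
rewrite normrM normr_id rmorphM; apply: ler_pM => //.
apply: le_trans (ler_normB _ _) _; rewrite !normrM rmorphD !rmorphM.
by apply: lerD; apply: ler_pM => //; [exact: dAw.2|exact: dBw.2].
Qed.

End Meromorphic.

(** * Rational functions near infinity *)

Section AtInfinity.
Context {R : realType}.
Local Notation C := (Cplx R).
Local Notation P1 := (P1 R).
Implicit Types (x y M K : R) (z w k a b : C) (A B F : C -> C) (f r : C -> P1).
Implicit Types (p q : {poly C}).

Lemma horner_upper p n : (size p <= n.+1)%N ->
  exists2 c, 0 <= c & forall z, 1 <= `|z| -> `|p.[z]| <= toC c * `|z| ^+ n.
Proof.
move=> sp; pose S : C := \sum_(i < n.+1) `|p`_i|.
have S0 : 0 <= S by apply: sumr_ge0.
have [c c0 cE] := norm_real S; rewrite ger0_norm// in cE.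
exists c => // z z1; rewrite (horner_coef_wide _ sp) -cE mulr_suml.
apply: le_trans (ler_norm_sum _ _ _) _; apply: ler_sum => i _.
rewrite normrM normrX; apply: ler_wpM2l => //.
by apply: ler_weXn2l => //; rewrite -ltnS.
Qed.

(** Below its leading term, a polynomial of degree [n] is [O (z^(n - 1))]. *)
Lemma horner_lower p n : size p = n.+1 ->
  exists c M, [/\ 0 < c, 1 <= M &
    forall z, toC M < `|z| -> toC c * `|z| ^+ n <= `|p.[z]|].
Proof.
move=> sp; pose p1 : {poly C} := \poly_(i < n) p`_i.
have pE z : p.[z] = p1.[z] + p`_n * z ^+ n.
  by rewrite horner_poly (horner_coef_wide _ (eq_leq sp)) big_ord_recr.
have sp1 : (size (p1 * 'X)%R <= n.+1)%N.
  apply: leq_trans (size_mul_leq _ _) _; rewrite size_polyX addn2 /= ltnS.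
  exact: size_poly.
have [c c0 cP] := horner_upper sp1.
have [l _ lE] := norm_real p`_n.
have l0 : 0 < l.
  rewrite -toC_gt0 -lE normr_gt0; have := lead_coefE p; rewrite sp /= => <-.
  by rewrite lead_coef_eq0 -size_poly_eq0 sp.
exists (l / 2), (1 + 2 * c / l); split; first by rewrite divr_gt0.
  by rewrite lerDl divr_ge0 ?mulr_ge0// ltW.
move=> z; have [x x0 xE] := norm_real z; rewrite xE ltr_toC => xM.
have cl : 0 <= 2 * c / l by rewrite divr_ge0 ?mulr_ge0// ltW.
have x1 : 1 < x by lra.
have cx : c <= l / 2 * x.
  have : 2 * c / l <= x by lra.
  by rewrite ler_pdivrMr//; lra.
have p1z : `|p1.[z]| <= toC (l / 2) * toC x ^+ n.
  have z1 : 1 <= `|z| by rewrite xE -(rmorph1 (@toC R)) ler_toC ltW.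
  have := cP z z1; rewrite hornerM hornerX normrM xE => H.
  have xp : 0 < toC x by rewrite toC_gt0; lra.
  rewrite -(ler_pM2r xp); apply: le_trans H _.
  rewrite mulrAC; apply: ler_wpM2r; first by rewrite exprn_ge0// ltW.
  by rewrite -rmorphM ler_toC.
rewrite pE addrC; apply: le_trans (lerB_normD _ _); rewrite normrM normrX xE lE lerBrDr.
apply: le_trans (lerD (lexx _) p1z) _.
by rewrite -mulrDl -rmorphD -splitr.
Qed.

Lemma horner_ratio_small p q e : (size p < size q)%N -> 0 < e ->
  exists M, forall z, toC M < `|z| -> q.[z] != 0 /\ `|p.[z]| <= toC e * `|q.[z]|.
Proof.
move=> spq e0; have [n sq] : exists n, size q = n.+1 by case: (size q) spq => // n; exists n.
have [c [M [c0 M1 qP]]] := horner_lower sq.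
have sp1 : (size (p * 'X)%R <= n.+1)%N.
  apply: leq_trans (size_mul_leq _ _) _; rewrite size_polyX addn2 /=.
  by rewrite -sq.
have [d d0 dP] := horner_upper sp1.
have de0 : 0 <= d / (c * e) by rewrite divr_ge0 ?mulr_ge0// ltW.
exists (M + d / (c * e)) => z; have [x x0 xE] := norm_real z; rewrite xE ltr_toC => xM.
have xM' : toC M < `|z| by rewrite xE ltr_toC; lra.
have z1 : 1 <= `|z| by rewrite xE -(rmorph1 (@toC R)) ler_toC; lra.
have xp : 0 < toC x by rewrite toC_gt0; lra.
have qz := qP z xM'.
have q0 : 0 < `|q.[z]|.
  by apply: lt_le_trans qz; rewrite mulr_gt0 ?toC_gt0// exprn_gt0// xE.
split; first by rewrite -normr_gt0.
have := dP z z1; rewrite hornerM hornerX normrM xE => H.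
rewrite -(ler_pM2r xp); apply: le_trans H _.
have dx : d <= e * x * c.
  have : d / (c * e) <= x by lra.
  by rewrite ler_pdivrMr ?mulr_gt0//; lra.
apply: (@le_trans _ _ (toC (e * x) * (toC c * toC x ^+ n))).
  rewrite mulrA -rmorphM; apply: ler_wpM2r; first by rewrite exprn_ge0// ltW.
  by rewrite ler_toC.
rewrite rmorphM [toC e * _ * toC x]mulrAC; apply: ler_wpM2l; last by rewrite -xE.
by rewrite mulr_ge0 ?ltW// toC_gt0.
Qed.

Lemma infty_filter_proper : ProperFilter (@infty_filter R).
Proof.
split; last split.
- move=> [M HM]; apply: (HM (toC (`|M| + 1))).
  rewrite norm_toC ltr_toC ger0_norm ?addr_ge0//.
  by apply: le_lt_trans (ler_norm _) _; rewrite ltrDl.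
- by exists 0.
- move=> P Q [M HM] [N HN]; exists (Num.max M N) => z.
  have [x x0 xE] := norm_real z; rewrite xE ltr_toC gt_max => /andP[Mx Nx].
  by split; [apply: HM|apply: HN]; rewrite xE ltr_toC.
- by move=> P Q PQ [M HM]; exists M => z /HM; exact: PQ.
Qed.

Lemma value_at_infty_small p q r : (forall z, r z = quo p.[z] q.[z]) ->
  (size p < size q)%N -> value_at_infty r = fin 0.
Proof.
move=> rE spq; have FF := infty_filter_proper.
rewrite /value_at_infty; apply: cvg_lim; first exact: hausdorff_P1.
have c0 : p.[z] / q.[z] @[z --> @infty_filter R] --> (0 : C).
  apply/cvgrPdist_le => _ /pos_toC[e e0 ->].
  have [M HM] := horner_ratio_small spq e0; exists M => z /HM[qz pz].
  rewrite sub0r normrN normrM normfV ler_pdivrMr ?normr_gt0//.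
have c1 : (fin (p.[z] / q.[z]) : P1) @[z --> @infty_filter R] --> (fin 0 : P1).
  by apply: (cvg_comp _ _ c0); exact: one_point_compactification_some_continuous.
have E : \forall z \near @infty_filter R, fin (p.[z] / q.[z]) = r z.
  have [M HM] := horner_ratio_small spq ltr01; exists M => z /HM[qz _].
  by rewrite rE /quo (negPf qz).
exact: (cvg_trans (near_eq_cvg E) c1).
Qed.

Lemma value_at_infty_large p q r : (forall z, r z = quo p.[z] q.[z]) ->
  (size q < size p)%N -> value_at_infty r = infty.
Proof.
move=> rE sqp; have FF := infty_filter_proper.
rewrite /value_at_infty; apply: cvg_lim; first exact: hausdorff_P1.
apply: cvg_infty => M.
have e0 : 0 < (`|M| + 1)^-1 by rewrite invr_gt0 ltr_wpDl.
have [N HN] := horner_ratio_small sqp e0; exists N => z /HN[pz qz] a.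
rewrite rE /quo; case: eqP => // /eqP qz0 [<-].
apply: (@lt_le_trans _ _ (toC (`|M| + 1))).
  by rewrite ltr_toC; apply: le_lt_trans (ler_norm _) _; rewrite ltrDl.
rewrite normrM normfV ler_pdivlMr ?normr_gt0//.
rewrite -(ler_pM2l (_ : 0 < toC (`|M| + 1)^-1)) ?toC_gt0//.
by rewrite mulrA -rmorphM mulVf ?gt_eqF ?ltr_wpDl// rmorph1 mul1r.
Qed.

(** [D] is [|z|^(2n)], the common scale of the four quantities. *)
Lemma horner_far p q n : size p = n.+1 -> size q = n.+1 ->
  exists M K c, [/\ 0 <= K, 0 < c & forall z, toC M < `|z| ->
    exists2 D : C, 0 < D &
    [/\ `|p.[z] * q.[z]| <= toC K * D,
        `|p^`().[z] * q.[z] - p.[z] * q^`().[z]| <= toC K * D,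
        toC c * D <= `|p.[z]| ^+ 2 & toC c * D <= `|q.[z]| ^+ 2]].
Proof.
move=> sp sq.
have [cp [Mp [cp0 Mp1 pL]]] := horner_lower sp.
have [cq [Mq [cq0 Mq1 qL]]] := horner_lower sq.
have [kp kp0 pU] := horner_upper (eq_leq sp).
have [kq kq0 qU] := horner_upper (eq_leq sq).
have sder (s : {poly C}) : size s = n.+1 -> (size s^`() <= n.+1)%N.
  by move=> ss; rewrite -ss ltnW// lt_size_deriv// -size_poly_eq0 ss.
have [kp' kp'0 pU'] := horner_upper (sder _ sp).
have [kq' kq'0 qU'] := horner_upper (sder _ sq).
pose K := kp * kq + (kp' * kq + kp * kq').
exists (Mp + Mq), K, (Num.min (cp ^+ 2) (cq ^+ 2)); split.
- by rewrite !addr_ge0 ?mulr_ge0.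
- by rewrite lt_min !exprn_gt0.
move=> z; have [x x0 xE] := norm_real z; rewrite xE ltr_toC => xM.
have zp : toC Mp < `|z| by rewrite xE ltr_toC; lra.
have zq : toC Mq < `|z| by rewrite xE ltr_toC; lra.
have z1 : 1 <= `|z| by rewrite xE -(rmorph1 (@toC R)) ler_toC; lra.
have zn0 : 0 < `|z| ^+ n by rewrite exprn_gt0// (lt_le_trans ltr01).
have mulb (u v : C) (k l : R) : `|u| <= toC k * `|z| ^+ n ->
    `|v| <= toC l * `|z| ^+ n -> `|u * v| <= toC (k * l) * (`|z| ^+ n) ^+ 2.
  move=> uk vl; rewrite normrM expr2 rmorphM mulrACA.
  by apply: ler_pM.
have D0 : 0 <= (`|z| ^+ n) ^+ 2 by rewrite exprn_ge0// ltW.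
have lowb (u : C) (c : R) : 0 < c -> Num.min (cp ^+ 2) (cq ^+ 2) <= c ^+ 2 ->
    toC c * `|z| ^+ n <= `|u| ->
    toC (Num.min (cp ^+ 2) (cq ^+ 2)) * (`|z| ^+ n) ^+ 2 <= `|u| ^+ 2.
  move=> c0 mc cu; apply: (@le_trans _ _ ((toC c * `|z| ^+ n) ^+ 2)).
    by rewrite exprMn; apply: ler_wpM2r => //; rewrite -rmorphXn ler_toC.
  have cge0 : 0 <= toC c by rewrite toC_ge0 ltW.
  have zge0 : 0 <= `|z| ^+ n by exact: ltW.
  apply: lerXn2r; last exact: cu.
  - by rewrite nnegrE; exact: mulr_ge0.
  - by rewrite nnegrE.
exists ((`|z| ^+ n) ^+ 2); first by rewrite exprn_gt0.
split.
- apply: le_trans (mulb _ _ _ _ (pU z z1) (qU z z1)) _.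
  by apply: ler_wpM2r => //; rewrite ler_toC /K lerDl addr_ge0 ?mulr_ge0.
- apply: le_trans (ler_normB _ _) _.
  apply: le_trans (lerD (mulb _ _ _ _ (pU' z z1) (qU z z1))
    (mulb _ _ _ _ (pU z z1) (qU' z z1))) _.
  by rewrite -mulrDl -rmorphD; apply: ler_wpM2r => //; rewrite ler_toC /K lerDr mulr_ge0.
- by apply: (lowb _ cp) => //; [rewrite ge_min lexx|exact: pL].
- by apply: (lowb _ cq) => //; [rewrite ge_min lexx orbT|exact: qL].
Qed.

(** [P], [Q] and [A], [B] stand for the values at a point of the coordinates of the
two factors, and [P'], [Q'], [a], [b] for their derivatives. The Wronskian of
the products splits as [P Q (a B - A b) + (P' Q - P Q') A B], and
[|A B| <= |A|^2 + |B|^2]. *)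
Lemma wronskian_quotient_bound (P Q P' Q' A B a b D : C) (K L c : R) :
  0 <= K -> 0 <= L -> 0 < c -> 0 < D -> A != 0 \/ B != 0 ->
  `|P * Q| <= toC K * D -> `|P' * Q - P * Q'| <= toC K * D ->
  toC c * D <= `|P| ^+ 2 -> toC c * D <= `|Q| ^+ 2 ->
  `|a * B - A * b| / (`|A| ^+ 2 + `|B| ^+ 2) <= toC L ->
  `|(P' * A + P * a) * (Q * B) - (P * A) * (Q' * B + Q * b)| /
    (`|P * A| ^+ 2 + `|Q * B| ^+ 2) <= toC (K * (L + 1) / c).
Proof.
move=> K0 L0 c0 D0 AB PQ W cP cQ; set S := `|A| ^+ 2 + `|B| ^+ 2.
have S0 : 0 < S.
  rewrite lt0r paddr_eq0 ?exprn_ge0// !expf_eq0/= !normr_eq0 negb_and.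
  by rewrite addr_ge0 ?exprn_ge0// andbT; case: AB => ->; rewrite ?orbT.
rewrite ler_pdivrMr// => Wf.
have ABS : `|A * B| <= S.
  rewrite normrM /S; have [x x0 ->] := norm_real A; have [y y0 ->] := norm_real B.
  by rewrite -!rmorphXn -rmorphM -rmorphD ler_toC; nra.
have den : toC c * D * S <= `|P * A| ^+ 2 + `|Q * B| ^+ 2.
  rewrite !normrM !exprMn mulrDr.
  by apply: lerD; apply: ler_wpM2r => //; exact: exprn_ge0.
have den0 : 0 < `|P * A| ^+ 2 + `|Q * B| ^+ 2.
  by apply: lt_le_trans den; rewrite !mulr_gt0 ?toC_gt0.
rewrite ler_pdivrMr//.
have -> : (P' * A + P * a) * (Q * B) - (P * A) * (Q' * B + Q * b) =
  (P * Q) * (a * B - A * b) + (P' * Q - P * Q') * (A * B) by ring.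
apply: le_trans (ler_normD _ _) _; rewrite [`|P * Q * _|]normrM [`|_ * (A * B)|]normrM.
apply: (@le_trans _ _ (toC K * D * (toC L * S) + toC K * D * S)).
  by apply: lerD; apply: ler_pM.
apply: (@le_trans _ _ (toC (K * (L + 1) / c) * (toC c * D * S))).
  have -> : toC (K * (L + 1) / c) * (toC c * D * S) = toC (K * (L + 1)) * (D * S).
    by rewrite -[toC c * D * S]mulrA mulrA -rmorphM divfK ?gt_eqF.
  rewrite rmorphM rmorphD rmorph1.
  by rewrite le_eqVlt; apply/orP; left; apply/eqP; ring.
by apply: ler_wpM2l => //; rewrite toC_ge0 divr_ge0 ?mulr_ge0 ?addr_ge0// ltW.
Qed.

(** Far from the origin neither [p] nor [q] vanishes, so [p A : q B] are coordinates
of the product without common zero. *)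
Lemma spherical_derivative_mul_far p q n r f :
  meromorphic f -> brody f ->
  (forall w, r w = quo p.[w] q.[w]) -> size p = n.+1 -> size q = n.+1 ->
  exists M L, forall z, toC M < `|z| -> `|spherical_derivative (mero_mul r f) z| <= toC L.
Proof.
move=> mf bf rE sp sq.
have [L0 HL] := (brodyP f).1 bf.
have L0_ge0 : 0 <= L0 by rewrite -toC_ge0; apply: le_trans (HL 0).
have [M [K [c [K0 c0 HM]]]] := horner_far sp sq.
have q0 : q != 0 by rewrite -size_poly_eq0 sq.
exists M, (K * (L0 + 1) / c) => z zM.
have [D D0 [PQ W cP cQ]] := HM z zM.
have [A [B [rA rB AB nB fE]]] := brody_quotient_at z mf bf.
have cD0 : 0 < toC c * D by rewrite mulr_gt0// toC_gt0.
have nz (u : C) : toC c * D <= `|u| ^+ 2 -> u != 0.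
  move=> /(lt_le_trans cD0); apply: contraTneq => ->.
  by rewrite normr0 expr0n ltxx.
have pz := nz _ cP; have qz := nz _ cQ.
have rN := regularM (regular_horner p z) rA.
have rD := regularM (regular_horner q z) rB.
have NDz : p.[z] * A z != 0 \/ q.[z] * B z != 0.
  by case: AB => n0; [left|right]; exact: mulf_neq0.
have gE := mero_mul_near rN rD NDz (mul_off_poles_quo q0 rE nB fE).
have dA := regular_is_derive rA; have dB := regular_is_derive rB.
have -> := spherical_derivative_quo gE (is_derive_mul (is_derive_horner p z) dA)
  (is_derive_mul (is_derive_horner q z) dB) NDz.
have := HL z; rewrite (spherical_derivative_quo fE dA dB AB).
have nn (u v w : C) : `| `|u| / (`|v| ^+ 2 + `|w| ^+ 2)| = `|u| / (`|v| ^+ 2 + `|w| ^+ 2).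
  by rewrite ger0_norm// divr_ge0// addr_ge0// exprn_ge0.
rewrite !nn; exact: (wronskian_quotient_bound K0 L0_ge0 c0 D0 AB PQ W cP cQ).
Qed.

End AtInfinity.

(** * The theorem *)

Theorem lemma3 (R : realType) (f r : Cplx R -> P1 R) :
  meromorphic f -> brody f ->
  rational_function r -> value_at_infty r <> fin 0 -> value_at_infty r <> infty ->
  meromorphic (mero_mul r f) /\ brody (mero_mul r f).
Proof.
move=> mf bf [p [q [q0 _ rE]]] r0 ry.
have {}rE w : r w = quo p.[w] q.[w] by rewrite rE rootE.
have gat z : quotient_at (mero_mul r f) z.
  by apply: (quotient_at_mul q0 rE); exact: brody_quotient_at.
split; first exact: quotient_at_meromorphic.
have [n sq] : exists n, size q = n.+1.
  by case: (size q) (size_poly_gt0 q) => [|n _]; [rewrite q0|exists n].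
have sp : size p = n.+1.
  rewrite -sq; case: (ltngtP (size p) (size q)) => // s.
  - by case: r0; exact: (value_at_infty_small rE).
  - by case: ry; exact: (value_at_infty_large rE).
have [M [L far]] := spherical_derivative_mul_far mf bf rE sp sq.
have [L' near_] := compact_locally_bounded (@compact_disc R M)
  (fun z _ => quotient_at_locally_bounded (gat z)).
apply/brodyP; exists (Num.max L L') => z.
have [x x0 xE] := norm_real z.
have [xM|Mx] := leP x M.
- apply: (@le_trans _ _ (toC L')); first by apply: near_; rewrite /= xE ler_toC.
  by rewrite ler_toC le_max lexx orbT.
- apply: (@le_trans _ _ (toC L)); first by apply: far; rewrite xE ltr_toC.
  by rewrite ler_toC le_max lexx.
Qed.
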